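(* The universality problem for one-clock timed visibly one-counter automata is undecidable; that is, the following problem is undecidable: given a one-clock timed visibly one-counter automaton $\mathcal{A}$ over a finite alphabet $\Sigma$, decide whether $L(\mathcal{A})=T\Sigma^+$.
   Context: **Timed words.** Let $\Sigma$ be a finite alphabet. A timed word over $\Sigma$ is a non-empty finite sequence $(a_1,t_1)\dots(a_n,t_n)\in(\Sigma\times\mathbb{R}_{\ge 0})^+$ with $t_1\le\dots\le t_n$; $T\Sigma^+$ is the set of all timed words over $\Sigma$. **Clocks.** For a finite set $\mathcal{X}$ of clock variables, $\Phi(\mathcal{X})$ is the set of clock constraints, i.e. conjunctions of formulas $x\sim c$ with $x\in\mathcal{X}$, $c\in\mathbb{N}$, $\sim\in\{<,\le,=,\ge,>\}$; $\mathtt{true}$ denotes an always satisfied constraint. A clock valuation is a map $\nu:\mathcal{X}\to\mathbb{R}_{\ge0}$; $\nu\models\phi$ means $\phi$ is true under $\nu$; $(\nu+\delta)(x)=\nu(x)+\delta$; $\nu[\lambda:=0]$ sets the clocks in $\lambda\subseteq\mathcal{X}$ to $0$ and leaves the others unchanged. **Timed one-counter automata.** A timed one-counter automaton is a tuple $(\Sigma,\mathcal{L},\mathcal{L}_0,\mathcal{L}_f,\mathcal{X},E)$ with a finite set $\mathcal{L}$ of locations, initial locations $\mathcal{L}_0\subseteq\mathcal{L}$, accepting locations $\mathcal{L}_f\subseteq\mathcal{L}$, a finite set of clocks $\mathcal{X}$, and a finite set of edges $E\subseteq\mathcal{L}\times\Sigma\times\Phi(\mathcal{X})\times\{push,pop,noop,empty?\}\times2^{\mathcal{X}}\times\mathcal{L}$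 (it is a timed pushdown automaton with a one-letter stack alphabet, whose stack content is identified with its height). A state is $(l,\nu,m)$ with $l\in\mathcal{L}$, $\nu$ a clock valuation, $m\in\mathbb{N}$. There is a transition from $(l,\nu,m)$ to $(l',\nu',m')$ with delay $\delta\in\mathbb{R}_{\ge0}$ and letter $a$ iff there is an edge $(l,a,\phi,op,\lambda,l')\in E$ with $\nu+\delta\models\phi$, $\nu'=(\nu+\delta)[\lambda:=0]$, and: $m'=m+1$ if $op=push$; $m\geq 1$ and $m'=m-1$ if $op=pop$ (so $pop$ is blocked when $m=0$); $m'=m$ if $op=noop$; $m=m'=0$ if $op=empty?$ (zero test). A run is a finite sequence of consecutive transitions; it is successful if it starts in a state $(l_0,\nu_0,0)$ with $l_0\in\mathcal{L}_0$ and all clocks $0$, and ends in a location in $\mathcal{L}_f$. A run with letters $a_1,\dots,a_n$ and delays $\delta_1,\dots,\delta_n$ is associated with the timed word $(a_1,\delta_1)(a_2,\delta_1+\delta_2)\dots(a_n,\delta_1+\dots+\delta_n)$. The language $L(\cdot)\subseteq T\Sigma^+$ is the set of timed words associated with successful runs. The automaton is one-clock if $|\mathcal{X}|=1$. **Visibly.** A timed one-counter automaton is visibly if $\Sigma$ can be partitioned into pairwise disjoint sets $\Sigma_{\mathsf{int}}\cup\Sigma_{\mathsf{call}}\cup\Sigma_{\mathsf{ret}}$ such that for every edge $(l,a,\phi,op,\lambda,l')$: $a\in\Sigma_{\mathsf{int}}$ iff $op=noop$; $a\in\Sigma_{\mathsf{call}}$ iff $op=push$; $a\in\Sigma_{\mathsf{ret}}$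 iff $op\in\{pop,empty?\}$. *)

(* Defs.v *)
From HB Require Import structures.
From mathcomp Require Import all_boot all_order all_algebra.
From mathcomp Require Import classical_sets reals.

Set Implicit Arguments.
Unset Strict Implicit.
Unset Printing Implicit Defensive.

Import Order.TTheory GRing.Theory Num.Theory.

(** ** Timed one-counter automata *)

Inductive cmp_op := CLt | CLe | CEq | CGe | CGt.

Definition nat_of_cmp (c : cmp_op) : nat :=
  match c with CLt => 0 | CLe => 1 | CEq => 2 | CGe => 3 | CGt => 4 end.

Lemma cmp_op_eq_dec : comparable cmp_op.
Proof. by move=> x y; rewrite /decidable; decide equality. Defined.

HB.instance Definition _ := hasDecEq.Build cmp_op (compareP cmp_op_eq_dec).

Inductive counter_op := Push | Pop | Noop | Empty.

Definition nat_of_counter_op (o : counter_op) : nat :=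
  match o with Push => 0 | Pop => 1 | Noop => 2 | Empty => 3 end.

Lemma counter_op_eq_dec : comparable counter_op.
Proof. by move=> x y; rewrite /decidable; decide equality. Defined.

HB.instance Definition _ := hasDecEq.Build counter_op (compareP counter_op_eq_dec).

(** A constraint is the list of its conjuncts; [true] is the empty list. *)
Definition constraint (X : finType) := seq (X * cmp_op * nat).

Definition edge (Sigma L X : finType) : Type :=
  (L * Sigma * constraint X * counter_op * {set X} * L)%type.

(** The finite edge set is presented as a list, since the type of constraints
    is infinite; only membership in this list matters. *)
Record toca := Toca {
  alphabet : finType;
  location : finType;
  clock : finType;
  initial : {set location};
  accepting : {set location};
  edges : seq (edge alphabet location clock)
}.

Section Semantics.
Local Open Scope ring_scope.
Variable R : realType.

Definition holds_cmp (c : cmp_op) (u v : R) : bool :=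
  match c with
  | CLt => u < v | CLe => u <= v | CEq => u == v | CGe => u >= v | CGt => u > v
  end.

(** Values are not required to be nonnegative here; every valuation occurring
    in a run from the zero valuation is, because delays are nonnegative. *)
Definition valuation (X : finType) := {ffun X -> R}.

Definition satisfies (X : finType) (nu : valuation X) (phi : constraint X) :=
  all (fun k => holds_cmp k.1.2 (nu k.1.1) k.2%:R) phi.

Definition delayed (X : finType) (nu : valuation X) (d : R) : valuation X :=
  [ffun x => nu x + d].

Definition reset (X : finType) (nu : valuation X) (lam : {set X}) :
  valuation X := [ffun x => if x \in lam then 0 else nu x].

Definition counter_step (o : counter_op) (m m' : nat) : Prop :=
  match o with
  | Push => m' = m.+1
  | Pop => (1 <= m)%N /\ m' = m.-1
  | Noop => m' = m
  | Empty => m = 0%N /\ m' = 0%N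
  end.

Variable A : toca.

Definition state : Type := (location A * valuation (clock A) * nat)%type.

Definition transition (s : state) (a : alphabet A) (d : R) (s' : state) : Prop :=
  let: (l, nu, m) := s in
  let: (l', nu', m') := s' in
  0 <= d /\
  exists phi o lam,
    [/\ (l, a, phi, o, lam, l') \in edges A,
        satisfies (delayed nu d) phi,
        nu' = reset (delayed nu d) lam &
        counter_step o m m'].

Inductive run : state -> seq (alphabet A * R) -> state -> Prop :=
| run_nil s : run s [::] s
| run_cons s a d s1 r s2 :
    transition s a d s1 -> run s1 r s2 -> run s ((a, d) :: r) s2.

Definition successful (r : seq (alphabet A * R)) : Prop :=
  exists l0 l nu m,
    [/\ l0 \in initial A, l \in accepting A &
        run (l0, [ffun=> 0], 0%N) r (l, nu, m)].

(** From letters with delays to letters with absolute times. *)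
Definition timed_word_of (Sigma : finType) (r : seq (Sigma * R)) :
  seq (Sigma * R) := zip (unzip1 r) (scanl +%R 0 (unzip2 r)).

Definition timed_words (Sigma : finType) : set (seq (Sigma * R)) :=
  [set w | [/\ w != [::], all (fun t => 0 <= t) (unzip2 w)
             & sorted <=%R (unzip2 w)]]%classic.

(** The empty run has no associated timed word, as these are nonempty. *)
Definition language : set (seq (alphabet A * R)) :=
  [set w | exists r, [/\ r != [::], successful r & w = timed_word_of r]]%classic.

Definition universal : Prop := language = @timed_words (alphabet A).

End Semantics.

Definition one_clock (A : toca) : Prop := #|clock A| = 1.

(** The classes may be empty, so MathComp's [partition] is not used. *)
Definition visibly (A : toca) : Prop :=
  exists Sint Scall Sret : {set alphabet A},
    [/\ [/\ [disjoint Sint & Scall], [disjoint Sint & Sret]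
          & [disjoint Scall & Sret]],
        Sint :|: Scall :|: Sret = [set: alphabet A]
      & forall l a phi o lam l', (l, a, phi, o, lam, l') \in edges A ->
          [/\ a \in Sint <-> o = Noop,
              a \in Scall <-> o = Push
            & a \in Sret <-> (o = Pop \/ o = Empty)]].

(** ** Computability: Kleene's partial recursive functions *)

Inductive recfun :=
| Zero
| Succ
| Proj of nat
| Comp of recfun & seq recfun
| Rec of recfun & recfun
| Mu of recfun.

(** [computes f xs y]: on the arguments [xs], [f] is defined with value [y]. *)
Inductive computes : recfun -> seq nat -> nat -> Prop :=
| computes_zero xs : computes Zero xs 0
| computes_succ x : computes Succ [:: x] x.+1
| computes_proj i xs : i < size xs -> computes (Proj i) xs (nth 0 xs i)
| computes_comp f gs xs ys y :
    size ys = size gs ->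
    (forall i, i < size gs -> computes (nth Zero gs i) xs (nth 0 ys i)) ->
    computes f ys y ->
    computes (Comp f gs) xs y
| computes_rec0 f g xs y :
    computes f xs y -> computes (Rec f g) (0 :: xs) y
| computes_recS f g n xs y z :
    computes (Rec f g) (n :: xs) y ->
    computes g (n :: y :: xs) z ->
    computes (Rec f g) (n.+1 :: xs) z
| computes_mu f xs n (v : nat -> nat) :
    (forall m, m < n -> computes f (m :: xs) (v m).+1) ->
    computes f (n :: xs) 0 ->
    computes (Mu f) xs n.

(** The decision problem "given an instance [i] (presented as the number
    [code i]) satisfying [D], does [P i] hold?" is decidable.  Nothing is asked
    of the decision procedure on numbers that do not code an instance in [D]. *)
Definition decidable_problem (I : Type) (code : I -> nat) (D P : I -> Prop) :
  Prop :=
  exists f : recfun, forall i, D i ->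
    (P i -> computes f [:: code i] 1) /\ (~ P i -> computes f [:: code i] 0).

(** ** Coding automata by natural numbers

    Elements of a finite type are represented by their rank in its enumeration
    and lists are coded by the bijection [CodeSeq.code : seq nat -> nat]. *)

Definition rank (T : finType) (x : T) : nat := enum_rank x.

Definition code_set (T : finType) (S : {set T}) : nat :=
  CodeSeq.code [seq rank x | x <- enum S].

Definition code_constraint (X : finType) (phi : constraint X) : nat :=
  CodeSeq.code
    [seq CodeSeq.code [:: rank k.1.1; nat_of_cmp k.1.2; k.2] | k <- phi].

Definition code_edge (Sigma L X : finType) (e : edge Sigma L X) : nat :=
  let: (l, a, phi, o, lam, l') := e in
  CodeSeq.code [:: rank l; rank a; code_constraint phi; nat_of_counter_op o;
                   code_set lam; rank l'].

Definition code_toca (A : toca) : nat :=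
  CodeSeq.code
    [:: #|alphabet A|; #|location A|; #|clock A|;
        code_set (initial A); code_set (accepting A);
        CodeSeq.code [seq code_edge e | e <- edges A]].

(* Main.v *)
From HB Require Import structures.
From mathcomp Require Import all_boot all_order all_algebra.
From mathcomp Require Import boolp reals.
From mathcomp Require Import zify lra.
From mathcomp Require classical_sets.
Require Import Defs.

(** The halting problem is reduced to non-universality.

    A partial recursive function is compiled into a token machine: a finite
    control acting on a string of tokens of fixed length, which at each step
    replaces the first token of some kind by one of another kind.  Registers are
    counted in tokens, and unused space is padding.

    A halting computation on a string of length [N - 1] is encoded by a timed
    word in which every letter is followed, one time unit later, by the letter it
    becomes in the next configuration; the first configuration is written with
    calls, the following ones with internal letters, and once the machine has
    halted everything is rewritten into returns.  A one-clock automaton can guess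
    a letter without a correct successor, but not an inserted letter.  That is
    what the counter is for: since every letter has a successor, an insertion
    makes the final block of returns longer than the initial block of calls, so
    that a return is read with an empty counter.

    The input [x] of the machine only occurs as the constant of two guards: the
    machine keeps loading input tokens until a special letter occurs, which must
    happen [x] time units after the beginning.  The automaton for input [x] is
    therefore a simple function of [x] and of the code [q] of its other edges,
    and diagonalisation amounts to choosing [x] as a code of [q] itself. *)

Set Implicit Arguments.
Unset Strict Implicit.
Unset Printing Implicit Defensive.

Import Order.TTheory GRing.Theory Num.Theory.

(** * Compiling recursive functions into counter programs *)

(** The premises of [computes_comp] by structural recursion: for a concrete list of functions they
    reduce to a conjunction, with no index to case on. *)
Fixpoint computes_seq (gs : seq recfun) (xs ys : seq nat) : Prop :=
  match gs, ys with
  | [::], [::] => True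
  | g :: gs', y :: ys' => computes g xs y /\ computes_seq gs' xs ys'
  | _, _ => False
  end.

Lemma computes_seqP gs xs ys :
  computes_seq gs xs ys <->
  size ys = size gs /\
  forall i, i < size gs -> computes (nth Zero gs i) xs (nth 0 ys i).
Proof.
elim: gs ys => [|g gs IH] [|y ys] //=; first by split=> // -[].
- by split=> // -[].
split=> [[gy /IH[-> gsP]]|[[sz] gsP]].
  by split=> // -[|i] //= /gsP.
by split; [exact: (gsP 0)|apply/IH; split=> // i; exact: (gsP i.+1)].
Qed.

Lemma computes_Comp f gs xs ys y :
  computes_seq gs xs ys -> computes f ys y -> computes (Comp f gs) xs y.
Proof. by move=> /computes_seqP[sz gsP]; apply: computes_comp. Qed.

(** * Arithmetic and the coding of lists by recursive functions *)

Definition rconst n := iter n (fun f => Comp Succ [:: f]) Zero.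

Lemma computes_const n xs : computes (rconst n) xs n.
Proof.
elim: n => [|n IH] /=; first exact: computes_zero.
by apply: (@computes_Comp _ _ _ [:: n]) => //; exact: computes_succ.
Qed.

Definition radd := Rec (Proj 0) (Comp Succ [:: Proj 1]).

Lemma computes_add n m : computes radd [:: n; m] (n + m).
Proof.
elim: n => [|n IH]; first by apply: computes_rec0; exact: computes_proj.
apply: computes_recS IH _; apply: (@computes_Comp _ _ _ [:: n + m]) => /=.
  by split=> //; exact: computes_proj.
exact: computes_succ.
Qed.

Definition rmul := Rec Zero (Comp radd [:: Proj 1; Proj 2]).

Lemma computes_mul n m : computes rmul [:: n; m] (n * m).
Proof.
elim: n => [|n IH]; first by apply: computes_rec0; exact: computes_zero.
apply: computes_recS IH _.
apply: (@computes_Comp _ _ _ [:: n * m; m]) => /=.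
  by do !split; exact: computes_proj.
by rewrite mulSnr; exact: computes_add.
Qed.

Definition rexp2 := Rec (rconst 1) (Comp radd [:: Proj 1; Proj 1]).

Lemma computes_exp2 n : computes rexp2 [:: n] (2 ^ n).
Proof.
elim: n => [|n IH]; first by apply: computes_rec0; exact: computes_const.
apply: computes_recS IH _.
apply: (@computes_Comp _ _ _ [:: 2 ^ n; 2 ^ n]) => /=.
  by do !split; exact: computes_proj.
by rewrite expnS mul2n -addnn; exact: computes_add.
Qed.

Definition rpred := Rec Zero (Proj 0).

Lemma computes_pred n : computes rpred [:: n] n.-1.
Proof.
elim: n => [|n IH]; first by apply: computes_rec0; exact: computes_zero.
by apply: computes_recS IH _; exact: computes_proj.
Qed.

(* The arguments are swapped: the subtrahend comes first. *)
Definition rsub := Rec (Proj 0) (Comp rpred [:: Proj 1]).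

Lemma computes_sub n m : computes rsub [:: n; m] (m - n).
Proof.
elim: n => [|n IH].
  by rewrite subn0; apply: computes_rec0; exact: computes_proj.
apply: computes_recS IH _.
apply: (@computes_Comp _ _ _ [:: m - n]) => /=.
  by split=> //; exact: computes_proj.
by rewrite subnS; exact: computes_pred.
Qed.

(** The step of the fold that defines [CodeSeq.code]: it puts an element in front of an already
    coded list. *)
Definition rcons2 :=
  Comp rmul [:: Comp rexp2 [:: Proj 0];
                Comp Succ [:: Comp radd [:: Proj 1; Proj 1]]].

Lemma computes_cons2 n m : computes rcons2 [:: n; m] (2 ^ n * m.*2.+1).
Proof.
apply: (@computes_Comp _ _ _ [:: 2 ^ n; m.*2.+1]); last exact: computes_mul.
do !split.
  apply: (@computes_Comp _ _ _ [:: n]); last exact: computes_exp2.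
  by split=> //; exact: computes_proj.
apply: (@computes_Comp _ _ _ [:: m.*2]); last exact: computes_succ.
split=> //; apply: (@computes_Comp _ _ _ [:: m; m]).
  by do !split; exact: computes_proj.
by rewrite -addnn; exact: computes_add.
Qed.

Definition rcode (gs : seq recfun) :=
  foldr (fun g h => Comp rcons2 [:: g; h]) Zero gs.

Lemma computes_code gs xs ys :
  computes_seq gs xs ys -> computes (rcode gs) xs (CodeSeq.code ys).
Proof.
elim: gs ys => [|g gs IH] [|y ys] //=; first by move=> _; exact: computes_zero.
move=> [gy /IH gsP].
apply: (@computes_Comp _ _ _ [:: y; CodeSeq.code ys]) => //.
exact: computes_cons2.
Qed.

(* When [sigma < 2 ^ q], [q] is found again as the binary logarithm. *)
Definition pair_exp q sigma := 2 ^ q + sigma.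

(** Minimises [x.+1 - 2 ^ m.+1], which vanishes at the least [m] such that [x < 2 ^ m.+1]. *)
Definition rpair_exp1 :=
  Mu (Comp rsub [:: Comp rexp2 [:: Comp Succ [:: Proj 0]];
                    Comp Succ [:: Proj 1]]).

Lemma computes_pair_exp1 q sigma :
  sigma < 2 ^ q -> computes rpair_exp1 [:: pair_exp q sigma] q.
Proof.
rewrite /pair_exp => ltq; set x := _ + _.
have body m : computes (Comp rsub [:: Comp rexp2 [:: Comp Succ [:: Proj 0]];
    Comp Succ [:: Proj 1]]) [:: m; x] (x.+1 - 2 ^ m.+1).
  apply: (@computes_Comp _ _ _ [:: 2 ^ m.+1; x.+1]); last exact: computes_sub.
  do !split.
    apply: (@computes_Comp _ _ _ [:: m.+1]); last exact: computes_exp2.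
    split=> //; apply: (@computes_Comp _ _ _ [:: m]); last exact: computes_succ.
    by split=> //; exact: computes_proj.
  apply: (@computes_Comp _ _ _ [:: x]); last exact: computes_succ.
  by split=> //; exact: computes_proj.
(* [computes_mu] wants the earlier values as successors; for [m < q], [x.+1 - 2 ^ m.+1] is the
   successor of [x - 2 ^ m.+1]. *)
apply: (@computes_mu _ _ _ (fun m => x - 2 ^ m.+1)) => [m ltm|].
  rewrite -subSn; first exact: body.
  by apply: leq_trans (leq_addr _ _); rewrite leq_exp2l.
have x_lt : x.+1 - 2 ^ q.+1 = 0 by rewrite expnS; lia.
by have := body q; rewrite x_lt.
Qed.

Definition rpair_exp2 := Comp rsub [:: Comp rexp2 [:: rpair_exp1]; Proj 0].

Lemma computes_pair_exp2 q sigma :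
  sigma < 2 ^ q -> computes rpair_exp2 [:: pair_exp q sigma] sigma.
Proof.
move=> ltq; apply: (@computes_Comp _ _ _ [:: 2 ^ q; pair_exp q sigma]).
  split; last by split=> //; exact: computes_proj.
  apply: (@computes_Comp _ _ _ [:: q]); last exact: computes_exp2.
  by split=> //; exact: computes_pair_exp1.
have {2}-> : sigma = pair_exp q sigma - 2 ^ q by rewrite /pair_exp addKn.
exact: computes_sub.
Qed.

Section RecfunInd.
Variable P : recfun -> Prop.
Hypothesis PZero : P Zero.
Hypothesis PSucc : P Succ.
Hypothesis PProj : forall i, P (Proj i).
Hypothesis PComp :
  forall f gs, P f -> (forall i, i < size gs -> P (nth Zero gs i)) -> P (Comp f gs).
Hypothesis PRec : forall f g, P f -> P g -> P (Rec f g).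
Hypothesis PMu : forall f, P f -> P (Mu f).

(** The list under [Comp] is a nested occurrence, for which the generated principle has no
    hypothesis; the inner [fix] supplies it. *)
Fixpoint recfun_nested_ind f : P f :=
  match f with
  | Zero => PZero
  | Succ => PSucc
  | Proj i => PProj i
  | Comp f gs =>
      PComp (recfun_nested_ind f)
        ((fix all_gs gs : forall i, i < size gs -> P (nth Zero gs i) :=
          match gs with
          | [::] => fun i lt_i => False_ind _ (notF lt_i)
          | g :: gs' => fun i =>
              match i with
              | 0 => fun _ => recfun_nested_ind g
              | i'.+1 => fun lt_i => all_gs gs' i' lt_i
              end
          end) gs)
  | Rec f g => PRec (recfun_nested_ind f) (recfun_nested_ind g)
  | Mu f => PMu (recfun_nested_ind f)
  end.

End RecfunInd.

(** The table [v] of all intermediate values is what the invariant of the compiled loop will refer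
    to. *)
Lemma computes_RecE f g xs y : computes (Rec f g) xs y ->
  exists n zs (v : nat -> nat),
    [/\ xs = n :: zs, computes f zs (v 0),
        forall i, i < n -> computes g [:: i, v i & zs] (v i.+1) & v n = y].
Proof.
move e: (Rec f g) => h c; elim: c e => //= {h xs y}.
  move=> f0 g0 xs y fy _ [-> _]; by exists 0, xs, (fun=> y).
move=> f0 g0 n xs y z _ IH gz _ [ef eg].
have [n' [zs [v [[<- <-] v0 vS vn]]]] := IH (congr2 Rec ef eg).
exists n.+1, xs, (fun i => if i == n.+1 then z else v i); split=> //.
- move=> i; rewrite ltnS leq_eqVlt => /orP[/eqP->|lt_in].
    by rewrite eqxx eqn_leq ltnn andbF eg vn.
  by rewrite eqSS (ltn_eqF lt_in) (ltn_eqF (leqW lt_in)); exact: vS.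
- by rewrite eqxx.
Qed.

(** * Counter programs and their macros *)

Inductive prog :=
| PSkip
| PInc of nat
| PDec of nat
| PSeq of prog & prog
| PWhile of nat & prog.

Definition upd (s : nat -> nat) r v : nat -> nat :=
  fun x => if x == r then v else s x.

Inductive exec : prog -> (nat -> nat) -> (nat -> nat) -> Prop :=
| exec_skip s : exec PSkip s s
| exec_inc r s : exec (PInc r) s (upd s r (s r).+1)
| exec_dec r s : exec (PDec r) s (upd s r (s r).-1)
| exec_seq p1 p2 s1 s2 s3 :
    exec p1 s1 s2 -> exec p2 s2 s3 -> exec (PSeq p1 p2) s1 s3
| exec_while0 r p s : s r = 0 -> exec (PWhile r p) s s
| exec_whileS r p s1 s2 s3 : 0 < s1 r ->
    exec p s1 s2 -> exec (PWhile r p) s2 s3 -> exec (PWhile r p) s1 s3.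

Ltac upd_solve :=
  rewrite /upd /=;
  repeat match goal with
  | |- context [if ?x == ?y then _ else _] => case: (x =P y) => ?
  end; subst; try lia.

Definition clear r := PWhile r (PDec r).

Lemma exec_clear s r : exec (clear r) s (upd s r 0).
Proof.
move: {2}(s r) (erefl (s r)) => n; elim: n s => [|n IH] s sr.
  have -> : upd s r 0 = s by apply/funext => x; upd_solve.
  exact: exec_while0.
have := @exec_whileS r (PDec r) s _ (upd s r 0) _ (exec_dec r s).
apply; first by rewrite sr.
have -> : upd s r 0 = upd (upd s r (s r).-1) r 0.
  by apply/funext => x; upd_solve.
by apply: IH; rewrite /upd eqxx sr.
Qed.

Definition move a t := PWhile a (PSeq (PDec a) (PInc t)).

Lemma exec_move s a t : a <> t ->
  exec (move a t) s (upd (upd s t (s t + s a)) a 0).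
Proof.
move=> neq; move: {2}(s a) (erefl (s a)) => n; elim: n s => [|n IH] s sa.
  have -> : upd (upd s t (s t + s a)) a 0 = s.
    by apply/funext => x; upd_solve.
  exact: exec_while0.
apply: exec_whileS; first by rewrite sa.
  by apply: exec_seq; [exact: exec_dec|exact: exec_inc].
set s1 := upd (upd s _ _) _ _.
suff -> : upd (upd s t (s t + s a)) a 0 = upd (upd s1 t (s1 t + s1 a)) a 0.
  by apply: IH; rewrite /s1; upd_solve.
by apply/funext => x; rewrite /s1; upd_solve.
Qed.

Definition move2 a t u := PWhile a (PSeq (PDec a) (PSeq (PInc t) (PInc u))).

Lemma exec_move2 s a t u : a <> t -> a <> u -> t <> u ->
  exec (move2 a t u) s (upd (upd (upd s t (s t + s a)) u (s u + s a)) a 0).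
Proof.
move=> at_ au tu; move: {2}(s a) (erefl (s a)) => n; elim: n s => [|n IH] s sa.
  set s' := upd _ _ _; have -> : s' = s.
    by apply/funext => x; rewrite /s'; upd_solve.
  exact: exec_while0.
apply: exec_whileS; first by rewrite sa.
  by do !apply: exec_seq; [exact: exec_dec|exact: exec_inc|exact: exec_inc].
set s1 := upd (upd (upd s _ _) _ _) _ _; set s' := upd _ _ _.
suff -> : s' = upd (upd (upd s1 t (s1 t + s1 a)) u (s1 u + s1 a)) a 0.
  by apply: IH; rewrite /s1; upd_solve.
by apply/funext => x; rewrite /s' /s1; upd_solve.
Qed.

Definition assign a b := PSeq (clear b) (move a b).

Lemma exec_assign s a b : a <> b ->
  exec (assign a b) s (upd (upd s b (s a)) a 0).
Proof.
move=> neq; apply: exec_seq (exec_clear _ _) _.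
set s1 := upd s b 0.
suff -> : upd (upd s b (s a)) a 0 = upd (upd s1 b (s1 b + s1 a)) a 0.
  exact: exec_move.
by apply/funext => x; rewrite /s1; upd_solve.
Qed.

(** A register can only be read by emptying it, so its content goes to both [b] and [t] and then
    returns from [t]. *)
Definition copy a b t :=
  PSeq (clear b) (PSeq (clear t) (PSeq (move2 a b t) (move t a))).

Lemma exec_copy s a b t : a <> b -> a <> t -> b <> t ->
  exec (copy a b t) s (upd (upd s b (s a)) t 0).
Proof.
move=> ab at_ bt; do 2!apply: exec_seq (exec_clear _ _) _.
apply: exec_seq (exec_move2 _ _ _ _) _ => //.
set s1 := upd _ _ _.
suff -> : upd (upd s b (s a)) t 0 = upd (upd s1 a (s1 a + s1 t)) t 0.
  by apply: exec_move => /esym.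
by apply/funext => x; rewrite /s1; upd_solve.
Qed.

(** [comp] is a parameter outside the [fix] so that the nested calls in [compile] pass the guard
    condition. *)
Definition compile_seq (comp : recfun -> nat -> prog) : seq recfun -> nat -> prog :=
  fix loop gs j :=
    if gs is g :: gs' then PSeq (comp g j) (loop gs' j.+1) else PSkip.

(* [compile f args o k] puts the value of [f] on the registers [args] into the
   register [o]; registers from [k] on are scratch. *)
Fixpoint compile (f : recfun) (args : seq nat) (o k : nat) : prog :=
  match f with
  | Zero => clear o
  | Succ => PSeq (copy (head 0 args) k k.+1) (PSeq (PInc k) (assign k o))
  | Proj i => PSeq (copy (nth 0 args i) k k.+1) (assign k o)
  | Comp f gs =>
      let n := size gs in
      PSeq
        (compile_seq (fun g j => compile g args j (k + n)) gs k)
        (compile f (iota k n) o (k + n))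
  | Rec f g =>
      PSeq (compile f (behead args) k.+1 k.+4)
     (PSeq (clear k)
     (PSeq (copy (head 0 args) k.+2 k.+3)
     (PSeq
        (PWhile k.+2
          (PSeq (PDec k.+2)
          (PSeq (compile g [:: k, k.+1 & behead args] k.+3 k.+4)
          (PSeq (assign k.+3 k.+1) (PInc k)))))
        (assign k.+1 o))))
  | Mu f =>
      let body := compile f (k :: args) k.+1 k.+2 in
      PSeq (clear k) (PSeq body
     (PSeq (PWhile k.+1 (PSeq (PInc k) body)) (assign k o)))
  end.

(** The frame condition below [k] is what keeps arguments and earlier results intact across
    subprograms; scratch registers may end up with anything. *)
Definition exec_sets p s k o v :=
  exists s', [/\ exec p s s', s' o = v & forall r, r < k -> r <> o -> s' r = s r].

Lemma computes_ZeroE xs y : computes Zero xs y -> y = 0.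
Proof. by move e: Zero => h c; case: c e. Qed.

Lemma computes_SuccE xs y : computes Succ xs y -> exists2 x, xs = [:: x] & y = x.+1.
Proof. by move e: Succ => h c; case: c e => // x _; exists x. Qed.

Lemma computes_ProjE i xs y :
  computes (Proj i) xs y -> i < size xs /\ y = nth 0 xs i.
Proof. by move e: (Proj i) => h c; case: c e => // j zs ltj [->]. Qed.

Lemma computes_CompE f gs xs y : computes (Comp f gs) xs y ->
  exists2 ys, computes_seq gs xs ys & computes f ys y.
Proof.
by move=> c; inversion c; subst; exists ys => //; apply/computes_seqP.
Qed.

Lemma computes_MuE f xs n : computes (Mu f) xs n ->
  exists v : nat -> nat,
    [/\ forall m, m < n -> 0 < v m, v n = 0
      & forall m, m <= n -> computes f (m :: xs) (v m)].
Proof.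
move e: (Mu f) => h c; case: c e => //= {h xs n} f' xs n v vP fn [ef].
exists (fun m => if m == n then 0 else (v m).+1); rewrite ef.
split=> [m lt_mn||m]; first by rewrite ltn_eqF.
  by rewrite eqxx.
rewrite leq_eqVlt => /orP[/eqP->|lt_mn]; first by rewrite eqxx.
by rewrite ltn_eqF //; exact: vP.
Qed.


Lemma compile_correct f args o k s y :
  computes f [seq s a | a <- args] y -> all (fun a => a < k) args -> o < k ->
  exec_sets (compile f args o k) s k o y.
Proof.
have agree (s1 s2 : nat -> nat) k1 l :
    (forall r, r < k1 -> s1 r = s2 r) -> all (fun a => a < k1) l ->
    [seq s1 a | a <- l] = [seq s2 a | a <- l].
  by move=> e /allP lt_l; apply/eq_in_map => r /lt_l/e.
have widen k1 k2 l : k1 <= k2 -> all (fun a => a < k1) l -> all (fun a => a < k2) l.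
  by move=> le_k; apply: sub_all => a /leq_trans; apply.
elim/recfun_nested_ind: f args o k s y => [||i|f gs IHf IHgs|f g IHf IHg|f IHf]
    args o k s y.
- move=> /computes_ZeroE-> _ _; exists (upd s o 0).
  by split=> [||r _ ro]; [exact: exec_clear|upd_solve|upd_solve].
- case/computes_SuccE=> x + ->; case: args => [|a [|b args]] //= [<-] {x}.
  case/andP=> lt_ak _ lt_ok.
  set s1 := upd (upd s k (s a)) k.+1 0.
  set s2 := upd s1 k (s1 k).+1.
  exists (upd (upd s2 o (s2 k)) k 0); split=> [||r rk ro].
  + apply: exec_seq; first by apply: exec_copy; lia.
    apply: exec_seq; first exact: exec_inc.
    by apply: exec_assign; lia.
  + by rewrite /s2 /s1; upd_solve.
  + by rewrite /s2 /s1; upd_solve.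
- case/computes_ProjE; rewrite size_map => lt_i -> /(all_nthP 0) lt_args lt_ok /=.
  rewrite (nth_map 0) //; have lt_ak := lt_args _ lt_i.
  set a := nth 0 args i in lt_ak *.
  set s1 := upd (upd s k (s a)) k.+1 0.
  exists (upd (upd s1 o (s1 k)) k 0); split=> [||r rk ro].
  + apply: exec_seq; first by apply: exec_copy; lia.
    by apply: exec_assign; lia.
  + by rewrite /s1; upd_solve.
  + by rewrite /s1; upd_solve.
- case/computes_CompE=> ys gsP fy lt_args lt_ok /=.
  set n := size gs; set gsprog := compile_seq _.
  (* Generalised to a suffix [hs] that writes from register [j] on: registers below [j] are kept,
     hence so are the results already written. *)
  have gs_exec hs zs j t : (forall i, i < size hs -> forall args o k s y,
        computes (nth Zero hs i) [seq s a | a <- args] y ->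
        all (fun a => a < k) args -> o < k ->
        exec_sets (compile (nth Zero hs i) args o k) s k o y) ->
      computes_seq hs [seq s a | a <- args] zs -> k <= j -> j + size hs <= k + n ->
      (forall r, r < k -> t r = s r) ->
      exists t', [/\ exec (gsprog hs j) t t',
        [seq t' a | a <- iota j (size hs)] = zs
        & forall r, r < j -> t' r = t r].
    elim: hs zs j t => [|h hs IH] [|z zs] j t //= IHhs.
      by move=> _ _ _ _; exists t; split=> //; exact: exec_skip.
    case=> hz hsP le_kj le_jn same.
    have [|||t1 [ex1 t1j same1]] := IHhs 0 isT args j (k + n) t z.
    + by rewrite (agree _ s k).
    + by apply: widen lt_args; lia.
    + by lia.
    have IHhs' i := IHhs i.+1.
    have [|||t2 [ex2 t2z same2]] := IH zs j.+1 t1 IHhs' hsP.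
    + by lia.
    + by lia.
    + by move=> r lt_rk; rewrite same1 ?same //; lia.
    exists t2; split.
    + exact: exec_seq ex1 ex2.
    + by rewrite t2z same2 // t1j.
    + by move=> r lt_rj; rewrite same2 ?same1 //; lia.
  have [//|t [ex1 tys same1]] := gs_exec gs ys k s IHgs gsP (leqnn k) (leqnn _).
  have [|||t2 [ex2 t2o same2]] := IHf (iota k n) o (k + n) t y; rewrite ?tys //.
  + by apply/allP => r; rewrite mem_iota => /andP[].
  + by lia.
  exists t2; split=> // [|r lt_rk ro]; first exact: exec_seq ex1 ex2.
  by rewrite same2 ?same1 //; lia.
- case/computes_RecE=> n [zs [v []]].
  case: args => [//|m ys] /= [sm <-] v0 vS vn /andP[lt_mk lt_ys] lt_ok.
  have [|||s1 [ex1 s1v same1]] := IHf ys k.+1 k.+4 s (v 0) => //.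
  + by apply: widen lt_ys; lia.
  + by lia.
  set s2 := upd s1 k 0.
  set s3 := upd (upd s2 k.+2 (s2 m)) k.+3 0.
  set body := PSeq (PDec k.+2) _.
  (* After [i] rounds, [k] holds [i], [k.+1] holds [v i] and [k.+2] counts the [j] rounds left;
     [k.+3] receives the next value. *)
  have loop j i t : t k = i -> t k.+1 = v i -> t k.+2 = j -> i + j = n ->
      (forall r, r < k -> t r = s r) ->
      exists t', [/\ exec (PWhile k.+2 body) t t', t' k.+1 = v n
                   & forall r, r < k -> t' r = s r].
    elim: j i t => [|j IH] i t ti tv tj ijn same.
      by exists t; split=> //; [exact: exec_while0|rewrite tv; congr v; lia].
    set t1 := upd t k.+2 (t k.+2).-1.
    have [|||t2 [ex2 t2v same2]] :=
      IHg [:: k, k.+1 & ys] k.+3 k.+4 t1 (v i.+1).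
    + have t1k : t1 k = i by rewrite /t1; upd_solve.
      have t1v : t1 k.+1 = v i by rewrite /t1; upd_solve.
      have t1ys : map t1 ys = map s ys.
        by apply: agree lt_ys => r lt_r; rewrite -same // /t1; upd_solve.
      rewrite /= t1k t1v t1ys.
      by apply: vS; lia.
    + by rewrite /= (widen k) //; lia.
    + by lia.
    set t3 := upd (upd t2 k.+1 (t2 k.+3)) k.+3 0.
    set t4 := upd t3 k (t3 k).+1.
    have [|||||t5 [ex5 t5v same5]] := IH i.+1 t4.
    + by rewrite /t4 /t3; upd_solve; rewrite same2 /t1; upd_solve.
    + by rewrite /t4 /t3; upd_solve.
    + by rewrite /t4 /t3; upd_solve; rewrite same2 /t1; upd_solve.
    + by lia.
    + move=> r lt_r; rewrite -same // /t4 /t3; upd_solve.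
      by rewrite same2 /t1; upd_solve.
    exists t5; split=> //; apply: exec_whileS ex5; first by lia.
    apply: exec_seq (exec_dec _ _) _; apply: exec_seq ex2 _.
    by apply: exec_seq (exec_inc _ _); apply: exec_assign; lia.
  have s3E r : r < k -> s3 r = s r.
    by move=> lt_r; rewrite /s3 /s2; upd_solve; rewrite same1; lia.
  have [|||||s4 [ex4 s4v same4]] := loop n 0 s3 => //.
  + by rewrite /s3 /s2; upd_solve.
  + by rewrite /s3 /s2; upd_solve.
  + by rewrite /s3 /s2; upd_solve; rewrite same1; lia.
  exists (upd (upd s4 o (s4 k.+1)) k.+1 0); split.
  + apply: exec_seq ex1 _; apply: exec_seq (exec_clear _ _) _.
    apply: exec_seq; first by apply: exec_copy; lia.
    by apply: exec_seq ex4 _; apply: exec_assign; lia.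
  + by rewrite -vn -s4v; upd_solve.
  + by move=> r lt_r ro; rewrite -same4 //; upd_solve.
- case/computes_MuE=> v [v_gt0 v0 vP] lt_args lt_ok /=.
  set body := compile f _ _ _.
  have bodyP t i : t k = i -> (forall r, r < k -> t r = s r) -> i <= y ->
      exists t', [/\ exec body t t', t' k.+1 = v i, t' k = i
                   & forall r, r < k -> t' r = s r].
    move=> ti same le_iy.
    have [|||t' [ex' t'v same']] := IHf (k :: args) k.+1 k.+2 t (v i).
    + by rewrite /= ti (agree _ s k) //; exact: vP.
    + by rewrite /= (widen k) //; lia.
    + by lia.
    exists t'; split=> //; first by rewrite same' //; lia.
    by move=> r lt_r; rewrite same' ?same //; lia.
  (* [k] holds the candidate and [k.+1] its value; the induction is on the distance [j] to [y], the
     first zero of [v]. *)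
  have loop j i t : t k = i -> t k.+1 = v i -> i + j = y ->
      (forall r, r < k -> t r = s r) ->
      exists t', [/\ exec (PWhile k.+1 (PSeq (PInc k) body)) t t', t' k = y
                   & forall r, r < k -> t' r = s r].
    elim: j i t => [|j IH] i t ti tv ijy same.
      exists t; split=> //; last by lia.
      by apply: exec_while0; rewrite tv -v0; congr v; lia.
    have [|||t1 [ex1 t1v t1k same1]] := bodyP (upd t k (t k).+1) i.+1.
    + by rewrite -ti; upd_solve.
    + by move=> r lt_r; rewrite -same //; upd_solve.
    + by lia.
    have [||t2 [ex2 t2k same2]] := IH i.+1 t1 t1k t1v => //; first by lia.
    exists t2; split=> //; apply: exec_whileS ex2.
      by rewrite tv; apply: v_gt0; lia.
    exact: exec_seq (exec_inc _ _) ex1.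
  have [|||t1 [ex1 t1v t1k same1]] := bodyP (upd s k 0) 0 => //.
  + by upd_solve.
  + by move=> r lt_r; upd_solve.
  have [//|//|t2 [ex2 t2k same2]] := loop y 0 t1 t1k t1v.
  exists (upd (upd t2 o (t2 k)) k 0); split.
  + apply: exec_seq (exec_clear _ _) _; apply: exec_seq ex1 _.
    by apply: exec_seq ex2 _; apply: exec_assign; lia.
  + by upd_solve.
  + by move=> r lt_r ro; rewrite -same2 //; upd_solve.
Qed.

(** * Token machines *)

Fixpoint replace_first (T : eqType) (a b : T) (w : seq T) :=
  if w is c :: w' then if c == a then b :: w' else c :: replace_first a b w'
  else [::].

Lemma size_replace_first (T : eqType) (a b : T) w :
  size (replace_first a b w) = size w.
Proof. by elim: w => //= c w IH; case: eqP => //= _; rewrite IH. Qed.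

(** The additive form avoids truncated subtraction and also covers [a = b]. *)
Lemma count_replace_first (T : eqType) (a b x : T) w : a \in w ->
  count_mem x (replace_first a b w) + (a == x) = count_mem x w + (b == x).
Proof.
elim: w => //= c w IH; rewrite inE eq_sym.
case: eqP => [->|_] /= aw; first by lia.
by have := IH aw; lia.
Qed.

Lemma replace_first_id (T : eqType) (a : T) w : replace_first a a w = w.
Proof. by elim: w => //= c w ->; case: eqP => // ->. Qed.

Section TokenMachine.
Variable K : nat.

Definition kind := 'I_K.+1.
Definition pad : kind := ord0.
Definition reg (r : nat) : kind := inord r.+1.

(* [(a, b, l1, l2)]: turn the first token [a] into [b] and go to [l1]; if there
   is no token [a], go to [l2]. *)
Definition instr (L : Type) : Type := (kind * kind * L * L)%type.

Definition map_instr (L L' : Type) (h : L -> L') (i : instr L) : instr L' :=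
  let: (a, b, l1, l2) := i in (a, b, h l1, h l2).

Definition step (L : Type) (code : L -> instr L) (c : L * seq kind) :
    L * seq kind :=
  let: (a, b, l1, l2) := code c.1 in
  if a \in c.2 then (l1, replace_first a b c.2) else (l2, c.2).

Inductive reach (L : Type) (code : L -> instr L) (live : pred L) :
    L * seq kind -> L * seq kind -> Prop :=
| reach_refl c : reach code live c c
| reach_step c c' :
    live c.1 -> reach code live (step code c) c' -> reach code live c c'.

Lemma reach_trans L (code : L -> instr L) live c1 c2 c3 :
  reach code live c1 c2 -> reach code live c2 c3 -> reach code live c1 c3.
Proof. by elim=> // c c' lc _ IH /IH; apply: reach_step. Qed.

Lemma step_map L L' (code : L -> instr L) (code' : L' -> instr L')
    (h : L -> L') l w :
  code' (h l) = map_instr h (code l) ->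
  step code' (h l, w) = (h (step code (l, w)).1, (step code (l, w)).2).
Proof.
rewrite /step /= => ->; case: (code l) => [[[a b] l1] l2] /=.
by case: ifP.
Qed.

(** Embeds the run of a subprogram. Agreement is asked on live labels only, since the exit of a
    subprogram becomes a label with an instruction of its own. *)
Lemma reach_map L L' (code : L -> instr L) (live : pred L)
    (code' : L' -> instr L') (live' : pred L') (h : L -> L') c c' :
  (forall l, live l -> live' (h l) /\ code' (h l) = map_instr h (code l)) ->
  reach code live c c' -> reach code' live' (h c.1, c.2) (h c'.1, c'.2).
Proof.
move=> hP; elim=> [[l w]|[l w] {}c' lc _ IH]; first exact: reach_refl.
have [lh ch] := hP _ lc; apply: reach_step => //=.
by rewrite (step_map _ ch).
Qed.

Lemma reach_iter L (code : L -> instr L) live c c' :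
  reach code live c c' -> exists n, iter n (step code) c = c'.
Proof.
by elim=> [d|d d' _ _ [n <-]]; [exists 0|exists n.+1; rewrite iterSr].
Qed.

(** * Counter programs as token machines *)

Fixpoint pos (p : prog) : finType :=
  match p with
  | PSeq p q => (pos p + pos q)%type
  | PWhile _ p => option (pos p)
  | _ => unit
  end.

Fixpoint entry p : pos p :=
  match p with
  | PSkip => tt
  | PInc _ => tt
  | PDec _ => tt
  | PSeq p q => inl (entry p)
  | PWhile _ p => None
  end.

(* The label [None] is the exit; [PInc] loops when it runs out of padding. *)
Fixpoint flow p : pos p -> instr (option (pos p)) :=
  match p with
  | PSkip => fun=> (pad, pad, None, None)
  | PInc r => fun=> (pad, reg r, None, Some tt)
  | PDec r => fun=> (reg r, pad, None, None)
  | PSeq p q => fun l =>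
      match l with
      | inl l => map_instr (oapp (fun l => Some (inl l)) (Some (inr (entry q))))
                   (flow l)
      | inr l => map_instr (omap inr) (flow l)
      end
  | PWhile r p => fun l =>
      match l with
      | None => (reg r, reg r, Some (Some (entry p)), None)
      | Some l => map_instr Some (flow l)
      end
  end.

Definition oflow p (l : option (pos p)) : instr (option (pos p)) :=
  if l is Some l' then flow l' else (pad, pad, None, None).

Definition represents (s : nat -> nat) (w : seq kind) :=
  forall r, r < K -> count_mem (reg r) w = s r.

Fixpoint max_reg p :=
  match p with
  | PSkip => 0
  | PInc r | PDec r => r
  | PSeq p q => maxn (max_reg p) (max_reg q)
  | PWhile r p => maxn r (max_reg p)
  end.

Lemma reg_eq r r' : r < K -> r' < K -> (reg r == reg r') = (r == r').
Proof. by move=> rK r'K; rewrite -val_eqE /= !inordK ?ltnS. Qed.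

Lemma reg_pad r : r < K -> (reg r == pad) = false.
Proof. by move=> rK; rewrite -val_eqE /= inordK ?ltnS. Qed.

Lemma sum_count_mem (T : finType) (w : seq T) :
  \sum_c count_mem c w = size w.
Proof.
elim: w => [|x w IH] /=; first by rewrite big1.
rewrite big_split /= IH -add1n; congr (_ + _).
rewrite (bigD1 x) //= eqxx big1 // => y; rewrite eq_sym => /negbTE -> //.
Qed.

(** Without padding, all tokens would belong to registers, whose counts would then sum up to the
    length. *)
Lemma pad_in s w : represents s w -> \sum_(r < K) s r < size w -> pad \in w.
Proof.
move=> sw; apply: contraLR; rewrite -has_pred1 has_count -leqNgt leqn0 => /eqP pw.
rewrite -leqNgt -sum_count_mem big_ord_recl pw leq_sum // => i _.
suff -> : lift ord0 i = reg i by rewrite sw.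
by apply/val_inj; rewrite /= inordK // ltnS.
Qed.

Definition stuck p (c : option (pos p) * seq kind) := step (@oflow p) c = c.

(* If there is not enough padding, the token machine loops. *)
Definition simulates p s s' :=
  exists B, forall w, represents s w ->
    (exists w', [/\ reach (@oflow p) isSome (Some (entry p), w) (None, w'),
                    represents s' w' & size w' = size w]) \/
    (size w < B /\ exists l w',
       [/\ reach (@oflow p) isSome (Some (entry p), w) (Some l, w')
         & @stuck p (Some l, w')]).

Lemma step_found L (code : L -> instr L) a b l1 l2 l w :
  code l = (a, b, l1, l2) -> a \in w ->
  step code (l, w) = (l1, replace_first a b w).
Proof. by rewrite /step /= => -> ->. Qed.

Lemma step_missing L (code : L -> instr L) a b l1 l2 l w :
  code l = (a, b, l1, l2) -> a \notin w -> step code (l, w) = (l2, w).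
Proof. by rewrite /step /= => -> /negbTE->. Qed.

Lemma represents_in s w r : represents s w -> r < K -> (reg r \in w) = (0 < s r).
Proof. by move=> sw rK; rewrite -sw // -has_count has_pred1. Qed.

Lemma exec_simulates p s s' : exec p s s' -> max_reg p < K -> simulates p s s'.
Proof.
elim=> {p s s'} /=.
- move=> s _; exists 0 => w sw; left; exists w; split=> //.
  apply: reach_step => //=; rewrite /step /= replace_first_id.
  by case: ifP => _; exact: reach_refl.
(* A string of at least this length has more tokens than the registers occupy, so [PInc] finds
   padding. *)
- move=> r s rK; exists (\sum_(i < K) s i).+1 => w sw.
  have [pw|npw] := boolP (pad \in w); [left|right].
    exists (replace_first pad (reg r) w); split; last exact: size_replace_first.
      apply: reach_step => //=.
      by rewrite (@step_found _ _ pad (reg r) None (Some tt)) //; exact: reach_refl.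
    move=> x xK; have := count_replace_first (reg r) (reg x) pw.
    rewrite [pad == _]eq_sym reg_pad // reg_eq // sw //.
    by rewrite /upd eq_sym; case: eqP => [->|_]; lia.
  split; first by rewrite ltnS leqNgt; apply: contra npw; exact: pad_in.
  exists tt, w; split; first exact: reach_refl.
  by rewrite /stuck (@step_missing _ _ pad (reg r) None (Some tt)).
- move=> r s rK; exists 0 => w sw; left.
  exists (if reg r \in w then replace_first (reg r) pad w else w); split.
  + apply: reach_step => //; rewrite /step /=.
    by case: ifP => _; exact: reach_refl.
  + move=> x xK; case: ifP => [rw|].
      have := count_replace_first pad (reg x) rw.
      rewrite [pad == _]eq_sym reg_pad // reg_eq // sw //.
      by rewrite /upd eq_sym; case: eqP => [->|_]; lia.
    rewrite (represents_in sw) // /upd sw //.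
    by case: eqP => [->|] //; lia.
  + by case: ifP; rewrite ?size_replace_first.
- move=> p q s1 s2 s3 _ IHp _ IHq; rewrite gtn_max => /andP[pK qK].
  have [B1 sim1] := IHp pK; have [B2 sim2] := IHq qK.
  set hp := oapp (fun l : pos p => Some (inl l)) (Some (inr (entry q))).
  have hpP l : isSome l -> isSome (hp l) /\
      @oflow (PSeq p q) (hp l) = map_instr hp (oflow l) by case: l.
  set hq : option (pos q) -> option (pos (PSeq p q)) := omap inr.
  have hqP l : isSome l -> isSome (hq l) /\
      @oflow (PSeq p q) (hq l) = map_instr hq (oflow l) by case: l.
  (* Either half may be the one that runs out of padding, so the bound is the larger of the two. *)
  exists (maxn B1 B2) => w sw.
  have [[w1 [r1 sw1 sz1]]|[lt_w [l [w1 [r1 st1]]]]] := sim1 w sw; last first.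
    right; split; first by lia.
    exists (inl l), w1; split; first exact: reach_map hpP r1.
    by rewrite /stuck; have := step_map w1 (hpP (Some l) isT).2; rewrite st1.
  have {}r1 := reach_map hpP r1.
  have [[w2 [r2 sw2 sz2]]|[lt_w [l [w2 [r2 st2]]]]] := sim2 w1 sw1; [left|right].
    exists w2; split=> //; last by rewrite sz2.
    exact: reach_trans r1 (reach_map hqP r2).
  split; first by lia.
  exists (inr l), w2; split; first exact: reach_trans r1 (reach_map hqP r2).
  by rewrite /stuck; have := step_map w2 (hqP (Some l) isT).2; rewrite st2.
- move=> r p s sr; rewrite gtn_max => /andP[rK pK].
  exists 0 => w sw; left; exists w; split=> //.
  apply: reach_step => //.
  rewrite (@step_missing _ _ (reg r) (reg r) (Some (Some (entry p))) None) //.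
    exact: reach_refl.
  by rewrite (represents_in sw) // sr.
- move=> r p s1 s2 s3 sr _ IHp _ IHw rpK.
  have := rpK; rewrite gtn_max => /andP[rK pK].
  have [B1 sim1] := IHp pK; have [B2 sim2] := IHw rpK.
  set hp : option (pos p) -> option (pos (PWhile r p)) := Some.
  have hpP l : isSome l -> isSome (hp l) /\
      @oflow (PWhile r p) (hp l) = map_instr hp (oflow l) by case: l.
  exists (maxn B1 B2) => w sw.
  have enter l w' :
      reach (@oflow (PWhile r p)) isSome (hp (Some (entry p)), w) (l, w') ->
      reach (@oflow (PWhile r p)) isSome (Some None, w) (l, w').
    move=> h; apply: reach_step => //.
    rewrite (@step_found _ _ (reg r) (reg r) (Some (Some (entry p))) None) //.
      by rewrite replace_first_id.
    by rewrite (represents_in sw).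
  have [[w1 [r1 sw1 sz1]]|[lt_w [l [w1 [r1 st1]]]]] := sim1 w sw; last first.
    right; split; first by lia.
    exists (Some l), w1; split; first by apply: enter; exact: reach_map hpP r1.
    by rewrite /stuck; have := step_map w1 (hpP (Some l) isT).2; rewrite st1.
  have {}r1 := enter _ _ (reach_map hpP r1).
  have [[w2 [r2 sw2 sz2]]|[lt_w [l [w2 [r2 st2]]]]] := sim2 w1 sw1; [left|right].
    by exists w2; split; [exact: reach_trans r1 r2| |rewrite sz2].
  split; first by lia.
  by exists l, w2; split=> //; exact: reach_trans r1 r2.
Qed.

End TokenMachine.

(** * Token machines with an input *)

(* The token machine fed with the input [x]: the label [init] loads one input
   token per step, and the label [start] replaces it at step [x]. *)
Fixpoint conf (K : nat) (L : Type) (code : L -> instr K L) (init start : L)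
    (x m k : nat) : L * seq (kind K) :=
  if k is k'.+1 then
    let c := conf code init start x m k' in
    if (k == x) && (pad K \in c.2) then (start, (step code c).2) else step code c
  else (init, nseq m (pad K)).

Section Machine.
Variables (p : prog) (K : nat).

Definition label : finType := option (option (option (pos p))).
Definition l_init : label := None.
Definition l_halt : label := Some None.
Definition l_test : label := Some (Some None).
Definition l_start : label := Some (Some (Some (entry p))).

(** The exit [None] of the program becomes [l_test], which halts if the output register [1] is
    nonempty and loops otherwise, so only a nonzero output leads to [l_halt]. *)
Definition code (l : label) : instr K label :=
  match l with
  | None => (pad K, reg K 0, l_init, l_init)
  | Some None => (pad K, pad K, l_halt, l_halt)
  | Some (Some None) => (reg K 1, reg K 1, l_halt, l_test)
  | Some (Some (Some l')) => map_instr (fun o => Some (Some o)) (flow K l')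
  end.

Hypotheses (pK : max_reg p < K) (K_gt1 : 1 < K).
Variable x : nat.
Hypothesis x_gt0 : 0 < x.

Notation conf := (conf code l_init l_start x).

(** Loading has no effect once the padding is used up, hence [minn k m]. *)
Lemma conf_loading m k : k < x -> exists w,
  [/\ conf m k = (l_init, w), represents (upd (fun=> 0) 0 (minn k m)) w,
      count_mem (pad K) w = m - k & size w = m].
Proof.
have K_gt0 : 0 < K by apply: ltnW.
elim: k => [_|k IH lt_kx] /=.
  exists (nseq m (pad K)); rewrite size_nseq count_nseq /= mul1n subn0.
  split=> // r rK; rewrite count_nseq /= eq_sym reg_pad // /upd min0n.
  by case: eqP.
have [w [-> rw cw sw]] := IH (ltnW lt_kx); rewrite ltn_eqF //=.
have [pw|npw] := boolP (pad K \in w).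
  rewrite (@step_found _ _ _ (pad K) (reg K 0) l_init l_init) //.
  exists (replace_first (pad K) (reg K 0) w); split=> //.
  - move=> r rK; have := count_replace_first (reg K 0) (reg K r) pw.
    rewrite [pad K == _]eq_sym reg_pad // reg_eq // rw //.
    move: pw; rewrite -has_pred1 has_count cw /upd [0 == r]eq_sym.
    by case: eqP => _; lia.
  - have := count_replace_first (reg K 0) (pad K) pw.
    by rewrite eqxx reg_pad // cw addn0 addn1 subnS => <-.
  - by rewrite size_replace_first.
rewrite (@step_missing _ _ _ (pad K) (reg K 0) l_init l_init) //.
exists w; move: npw; rewrite -has_pred1 has_count cw => le_mk; split=> //; last by lia.
by move=> r rK; rewrite rw //; congr upd; lia.
Qed.

Lemma conf_loaded m : x <= m -> exists w,
  [/\ conf m x = (l_start, w), represents (upd (fun=> 0) 0 x) w & size w = m].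
Proof.
have K_gt0 : 0 < K by apply: ltnW.
move=> le_xm; have lt_x : x.-1 < x by rewrite prednK.
have [w [cE rw cw sw]] := conf_loading m lt_x.
have pw : pad K \in w by rewrite -has_pred1 has_count cw; lia.
(* Step [x] loads the last input token and switches to [l_start] at once, so [x] tokens are loaded
   and not [x.-1]. *)
have cE' : conf m x.-1.+1 = (l_start, replace_first (pad K) (reg K 0) w).
  rewrite /= cE /= prednK // eqxx pw /=.
  by rewrite (@step_found _ _ _ (pad K) (reg K 0) l_init l_init).
rewrite prednK // in cE'; rewrite cE'.
exists (replace_first (pad K) (reg K 0) w); split=> //.
  move=> r rK; have := count_replace_first (reg K 0) (reg K r) pw.
  rewrite [pad K == _]eq_sym reg_pad // reg_eq // rw //.
  by rewrite /upd [0 == r]eq_sym; case: eqP => _; lia.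
by rewrite size_replace_first.
Qed.

Lemma conf_after m j : conf m (x + j) = iter j (step code) (conf m x).
Proof.
elim: j => [|j IH]; first by rewrite addn0.
rewrite addnS iterS -IH /=; case: eqP => //; lia.
Qed.

(** The input does not fit: no padding is left for step [x], so the test in [conf] fails and the
    machine stays in its loading loop. *)
Lemma conf_overflow m k : m < x -> (conf m k).1 = l_init.
Proof.
move=> lt_mx; have [/conf_loading|le_xk] := ltnP k x.
  by move=> /(_ m)[w [->]].
have lt_x : x.-1 < x by rewrite prednK.
have [w [cE rw cw sw]] := conf_loading m lt_x.
have npw : pad K \notin w by rewrite -has_pred1 has_count cw; lia.
have stepE : step code (l_init, w) = (l_init, w).
  exact: (@step_missing _ _ _ (pad K) (reg K 0) l_init l_init).
have cE' : conf m x.-1.+1 = (l_init, w) by rewrite /= cE /= (negbTE npw) andbF.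
rewrite prednK // in cE'.
by rewrite -(subnKC le_xk) conf_after cE' iter_fix.
Qed.

Lemma halt_absorbing j c : c.1 = l_halt -> (iter j (step code) c).1 = l_halt.
Proof.
elim: j => // j IH /IH /=; case: (iter _ _ _) => l w /= ->.
by rewrite /step /=; case: ifP.
Qed.

Definition h_flow (o : option (pos p)) : label := Some (Some o).

Lemma code_h_flow o : isSome o -> predT (h_flow o) /\
  code (h_flow o) = map_instr h_flow (oflow K o).
Proof. by case: o. Qed.

Lemma machine_halts s : exec p (upd (fun=> 0) 0 x) s -> 0 < s 1 ->
  exists m k, (conf m k).1 = l_halt.
Proof.
move=> ps s1; have [B sim] := exec_simulates ps pK.
have [//|w [cE rw sw]] := @conf_loaded (maxn B x); first exact: leq_maxr.
(* Long enough to load [x] tokens and to exclude running out of padding. *)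
exists (maxn B x).
have [[w' [r1 rw' sw']]|] := sim w rw; last by rewrite sw => -[]; lia.
have [n nE] := reach_iter (reach_map code_h_flow r1).
exists (x + n.+1); rewrite conf_after cE iterS.
rewrite [iter _ _ _]nE /=.
rewrite (@step_found _ _ _ (reg K 1) (reg K 1) l_halt l_test) //.
by rewrite (represents_in rw').
Qed.

(** Whether the program exits with output [0] or runs out of padding, the machine arrives at a fixed
    configuration that is not halting; as [l_halt] is absorbing, it was not visited before
    either. *)
Lemma machine_diverges s : exec p (upd (fun=> 0) 0 x) s -> s 1 = 0 ->
  forall m k, (conf m k).1 != l_halt.
Proof.
move=> ps s1 m k; have [B sim] := exec_simulates ps pK.
have [lt_mx|le_xm] := ltnP m x; first by rewrite conf_overflow.
have [/conf_loading|le_xk] := ltnP k x.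
  by move=> /(_ m)[w [->]].
have [w [cE rw sw]] := conf_loaded le_xm.
rewrite -(subnKC le_xk) conf_after cE; move: (k - x) => {le_xk}k.
have [c [n nE] [cfix cl]] : exists2 c, exists n, iter n (step code) (l_start, w) = c
    & step code c = c /\ c.1 != l_halt.
  have [[w' [r1 rw' _]]|[_ [l [w' [r1 st]]]]] := sim w rw.
    exists (l_test, w'); first exact: reach_iter (reach_map code_h_flow r1).
    split=> //; apply: (@step_missing _ _ _ (reg K 1) (reg K 1) l_halt l_test) => //.
    by rewrite (represents_in rw') // s1.
  exists (h_flow (Some l), w'); first exact: reach_iter (reach_map code_h_flow r1).
  by split=> //; have := step_map w' (code_h_flow (erefl : Some l)).2; rewrite st.
apply: contraNneq cl => /(halt_absorbing n).
by rewrite -iterD addnC iterD nE iter_fix // => ->.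
Qed.

End Machine.

(** * The automaton of a transition scheme *)

Inductive letter_class := Internal | Call | Return.

(** Isolates what the automaton needs from the encoding: a deterministic control [next_mode], a
    relation [allowed] between a letter read in some mode and the letter one time unit later, and a
    letter [go] tied to a fixed time. *)
Record scheme := Scheme {
  letter : finType;
  mode : finType;
  class_of : letter -> letter_class;
  next_mode : mode -> letter -> option mode;
  first_mode : mode;
  allowed : mode -> letter -> pred letter;
  go : letter
}.

Section Language.
Local Open Scope ring_scope.
Variables (R : realType) (S : scheme) (c : nat).
Notation word := (seq (letter S * R)).

Definition is_return (a : letter S) := if class_of a is Return then true else false.

(** [m.-1] serves both operations of a return, as a zero test leaves [0] at [0]; the counter thus
    depends on the letters only. *)
Definition height (a : letter S) (m : nat) : nat :=
  match class_of a with Internal => m | Call => m.+1 | Return => m.-1 end.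

(** [v] is the time since the letter in question. The verdict falls at the first letter where it
    reaches [1]; a second letter at the same time is not looked at, zero delays being bad by
    themselves. *)
Fixpoint bad_successor (P : pred (letter S)) (v : R) (r : word) : bool :=
  if r is (b, d) :: r' then
    if v + d < 1 then bad_successor P (v + d) r'
    else if v + d == 1 then ~~ P b else true
  else true.

Fixpoint bad_go (v : R) (r : word) : bool :=
  if r is (a, d) :: r' then
    ((a == go S) && (v + d != c%:R)) || bad_go (v + d) r'
  else false.

Definition bad_letter (q : mode S) (m : nat) (a : letter S) (r : word) : bool :=
  if is_return a then m == 0%N else bad_successor (allowed q a) 0 r.

Fixpoint bad_tail (q : mode S) (m : nat) (r : word) : bool :=
  if r is (a, d) :: r' then
    [|| d == 0, bad_letter q m a r' |
        if next_mode q a is Some q' then bad_tail q' (height a m) r' else true]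
  else false.

(** The delay of the first letter is ignored: it is neither tested against [0] nor counted by
    [bad_go]. *)
Definition bad_word (r : word) : bool :=
  if r is (a, d) :: r' then
    [|| bad_letter (first_mode S) 0 a r',
        (if next_mode (first_mode S) a is Some q'
         then bad_tail q' (height a 0) r' else true) |
        bad_go 0 r']
  else false.

End Language.

(** * The one-clock automaton and its runs *)

Section Automaton.
Variables (S : scheme) (N c : nat).
Notation Gamma := (letter S).
Notation Q := (mode S).
Implicit Types (a b : Gamma) (q : Q).

(** A run looks for a single violation, so one clock suffices: in [Main q] it measures the time
    since the previous letter, in [Wait q a] since a guessed letter [a], in [Timer] since the first
    letter. [Acc] accepts every continuation, [End] only the empty one. *)
Inductive loc := Acc | End | Ini | Timer | Main of Q | Wait of Q & Gamma.

(** The four fixed locations come first, so that their numbers do not depend on the scheme. *)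
Definition loc_rank (l : loc) : nat :=
  match l with
  | Acc => 0
  | End => 1
  | Ini => 2
  | Timer => 3
  | Main q => 4 + rank (inl q : Q + Q * Gamma)
  | Wait q a => 4 + rank (inr (q, a) : Q + Q * Gamma)
  end.

Definition nb_loc := 4 + #|{: Q + Q * Gamma}|.

Lemma loc_rank_lt l : loc_rank l < nb_loc.
Proof. by case: l => *; rewrite /nb_loc /= /rank ?ltn_add2l ?ltn_ord. Qed.

Lemma loc_rank_inj : injective loc_rank.
Proof.
have rI (u v : Q + Q * Gamma) : 4 + rank u = 4 + rank v -> u = v.
  by move=> /addnI/val_inj/enum_rank_inj.
by move=> [||||q|q a] [||||q'|q' a'] //= /rI // [] // -> // ->.
Qed.

HB.instance Definition _ := Equality.copy loc (inj_type loc_rank_inj).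

Definition op_of (a : Gamma) (o : counter_op) : bool :=
  match class_of a, o with
  | Internal, Noop | Call, Push | Return, Pop | Return, Empty => true
  | _, _ => false
  end.

Definition guard (k : cmp_op) (n : nat) : constraint 'I_1 := [:: (ord0, k, n)].

(* A branch carries its guard and whether it resets the clock. *)
Definition branch : Type := (constraint 'I_1 * bool * loc)%type.

Definition letter_branches (q : Q) (a : Gamma) (o : counter_op) : seq branch :=
  (if is_return a then if o == Empty then [:: ([::], false, Acc)] else [::]
   else [:: ([::], true, Wait q a); ([::], true, End)]) ++
  [:: if next_mode q a is Some q' then ([::], true, Main q')
      else ([::], false, Acc)].

Definition branches (l : loc) (a : Gamma) (o : counter_op) : seq branch :=
  match l with
  | Acc => [:: ([::], false, Acc)]
  | End => [::]
  | Ini => ([::], true, Timer) :: letter_branches (first_mode S) a o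
  | Timer => [:: ([::], false, Timer)]
  | Main q => (guard CEq 0, false, Acc) :: letter_branches q a o
  | Wait q b =>
      [:: (guard CLt 1, false, l); (guard CLt 1, false, End);
          (guard CGt 1, false, Acc)] ++
      (if allowed q b a then [::] else [:: (guard CEq 1, false, Acc)])
  end.

Definition all_locs : seq loc :=
  [:: Acc; End; Ini; Timer] ++ [seq Main q | q <- enum Q] ++
  [seq Wait q a | q <- enum Q, a <- enum Gamma].

(** The number of locations is a free parameter, which diagonalisation sets from the input; surplus
    locations carry no edge. *)
Definition location_of (l : loc) : 'I_N.+1 := inord (loc_rank l).

Definition mk_edge (l : loc) (a : Gamma) (o : counter_op) (t : branch) :
    edge Gamma 'I_N.+1 'I_1 :=
  (location_of l, a, t.1.1, o, if t.1.2 then [set: 'I_1] else set0,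
   location_of t.2).

Definition edge_data : Type := (loc * Gamma * counter_op * branch)%type.

Definition edge_of (e : edge_data) : edge Gamma 'I_N.+1 'I_1 :=
  mk_edge e.1.1.1 e.1.1.2 e.1.2 e.2.

Definition edges_at (l : loc) (a : Gamma) (o : counter_op) : seq edge_data :=
  if op_of a o then [seq (l, a, o, t) | t <- branches l a o] else [::].

Definition base_edges : seq edge_data :=
  flatten [seq flatten [seq edges_at l a o | o <- [:: Push; Pop; Noop; Empty]]
          | l <- all_locs, a <- enum Gamma].

(* Repeating an edge makes the code of the edges exceed the numbers of
   locations and of letters. *)
Definition padding_edges : seq edge_data :=
  nseq (nb_loc + #|Gamma|) (Acc, go S, Noop, ([::], false, Acc)).

(** The guards with [CLt] and [CGt] together express a clock value other than [c]; no other edge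
    mentions [c]. *)
Definition go_edge (k : cmp_op) : edge_data :=
  (Timer, go S, Noop, (guard k c, false, Acc)).

Definition automaton : toca := {|
  alphabet := Gamma;
  location := 'I_N.+1;
  clock := 'I_1;
  initial := [set location_of Ini];
  accepting := [set location_of Acc; location_of End];
  edges := [seq edge_of e
    | e <- [:: go_edge CLt, go_edge CGt & padding_edges ++ base_edges]]
|}.

Hypothesis go_internal : class_of (go S) = Internal.
Hypothesis N_large : nb_loc <= N.+1.

Lemma location_of_inj : injective location_of.
Proof.
move=> l l' /(congr1 val); rewrite /= !inordK; first exact: loc_rank_inj.
  by apply: leq_trans N_large; exact: loc_rank_lt.
by apply: leq_trans N_large; exact: loc_rank_lt.
Qed.

Lemma mem_all_locs l : l \in all_locs.
Proof.
rewrite /all_locs 2!mem_cat; case: l => [||||q|q a]; rewrite ?inE //.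
  by rewrite map_f ?mem_enum ?orbT.
by apply/orP; right; apply/orP; right; apply/allpairsP; exists (q, a); rewrite !mem_enum.
Qed.

Lemma base_edgesP l a o t :
  reflect (op_of a o /\ t \in branches l a o) ((l, a, o, t) \in base_edges).
Proof.
apply: (iffP (@flattenP _ _ _)) => [[s /allpairsP[[l1 a1] [_ _ ->]]]|].
  move=> /flattenP[s' /mapP[o1 _ ->]]; rewrite /edges_at; case: ifP => // opao.
  by case/mapP=> t1 tb [-> -> -> ->].
move=> [opao tb].
exists (flatten [seq edges_at l a o | o <- [:: Push; Pop; Noop; Empty]]).
  by apply/allpairsP; exists (l, a); rewrite mem_all_locs mem_enum.
apply/flattenP; exists (edges_at l a o); first by apply: map_f; case: o opao tb.
by rewrite /edges_at opao map_f.
Qed.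

Lemma edgesP e :
  (e \in edges automaton) <->
  ((exists l a o t, [/\ op_of a o, t \in branches l a o & e = mk_edge l a o t]) \/
   (e = edge_of (go_edge CLt) \/ e = edge_of (go_edge CGt))).
Proof.
have pad_base : (Acc, go S, Noop, ([::], false, Acc)) \in base_edges.
  by apply/base_edgesP; rewrite inE eqxx /op_of go_internal.
split=> [/mapP[e']|].
  rewrite 2!inE mem_cat mem_nseq => e'P ->.
  have base e1 : e1 \in base_edges -> exists l a o t,
      [/\ op_of a o, t \in branches l a o & edge_of e1 = mk_edge l a o t].
    by case: e1 => [[[l a] o] t] /base_edgesP[]; exists l, a, o, t.
  case/or4P: e'P => [/eqP->|/eqP->|/andP[_ /eqP->]|/base]; last by left.
  - by right; left.
  - by right; right.
  - by left; apply: base.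
case=> [[l [a [o [t [opa tb ->]]]]]|[->|->]].
- have eb := introT (base_edgesP l a o t) (conj opa tb).
  have : (l, a, o, t) \in [:: go_edge CLt, go_edge CGt & padding_edges ++ base_edges].
    by rewrite 2!in_cons mem_cat; apply/or4P/Or44.
  exact: (map_f edge_of).
- by apply: (map_f edge_of); exact: mem_head.
- by apply: (map_f edge_of); rewrite in_cons mem_head orbT.
Qed.

Lemma automaton_one_clock : one_clock automaton.
Proof. by rewrite /one_clock card_ord. Qed.

Lemma automaton_visibly : visibly automaton.
Proof.
exists [set a | if class_of a is Internal then true else false],
  [set a | if class_of a is Call then true else false],
  [set a | if class_of a is Return then true else false]; split.
- by split; apply/pred0P => a /=; rewrite !inE; case: class_of.
- by apply/setP => a; rewrite !inE; case: class_of.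
move=> l a phi o lam l' /edgesP[[l1 [a1 [o1 [t [opao _ [_ -> _ -> _ _]]]]]]|].
  move: opao; rewrite /op_of !inE.
  by case: class_of; case: o1 => // _; do !split=> //; auto; case.
by case=> [] [_ -> _ -> _ _]; rewrite !inE go_internal; do !split=> //; case.
Qed.

Section Runs.
Local Open Scope ring_scope.
Variable R : realType.
Notation word := (seq (Gamma * R)).
Notation A := automaton.

Definition st (l : loc) (v : R) (m : nat) : state R A :=
  (location_of l, [ffun=> v], m).

Definition accepts (s : state R A) (r : word) : Prop :=
  exists s', s'.1.1 \in accepting A /\ @run R A s r s'.

Lemma accepts_nil s : accepts s [::] <-> s.1.1 \in accepting A.
Proof.
split=> [[s' [acc r]]|acc]; last by exists s; split=> //; exact: run_nil.
by inversion r; subst.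
Qed.

Lemma accepts_cons s a d r : accepts s ((a, d) :: r) <->
  exists s', @transition R A s a d s' /\ accepts s' r.
Proof.
split=> [[s' [acc r']]|[s1 [tr [s' [acc r']]]]].
  by inversion r'; subst; exists s1; split=> //; exists s'.
by exists s'; split=> //; exact: run_cons tr r'.
Qed.

Definition next_clock (t : branch) (v : R) := if t.1.2 then 0 else v.

Lemma delayed_const (v d : R) :
  delayed [ffun=> v] d = [ffun=> v + d] :> valuation R 'I_1.
Proof. by apply/ffunP => i; rewrite !ffunE. Qed.

Lemma reset_const (v : R) (b : bool) :
  reset [ffun=> v] (if b then [set: 'I_1] else set0) =
  [ffun=> if b then 0 else v] :> valuation R 'I_1.
Proof. by apply/ffunP => i; rewrite !ffunE; case: b; rewrite inE. Qed.

Lemma satisfies_guard (v : R) k n :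
  satisfies ([ffun=> v] : valuation R 'I_1) (guard k n) = holds_cmp k v n%:R.
Proof. by rewrite /satisfies /= ffunE andbT. Qed.

Definition steps_to l v m a d r (o : counter_op) (t : branch) :=
  [/\ satisfies ([ffun=> v + d] : valuation R 'I_1) t.1.1,
      op_of a o & exists2 m', counter_step o m m' &
      accepts (st t.2 (next_clock t (v + d)) m') r]
  /\ t \in branches l a o.

Lemma accepts_step l v m a d r : 0 <= d ->
  accepts (st l v m) ((a, d) :: r) <->
  (exists o t, steps_to l v m a d r o t) \/
  [/\ l = Timer, a = go S, v + d != c%:R & accepts (st Acc (v + d) m) r].
Proof.
move=> d_ge0; rewrite accepts_cons; split.
  case=> [[[l' nu] m']] [[_ [phi [o [lam [/edgesP e sat -> cs]]]]] acc].
  rewrite delayed_const in sat acc.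
  case: e => [[l1 [a1 [o1 [t [op tb [/location_of_inj el ea ep eo elam el']]]]]]|e].
    left; exists o, t; subst; rewrite reset_const in acc; do !split=> //.
    by exists m'.
  right; have [el ea el' acc' neq] : [/\ l = Timer, a = go S, l' = location_of Acc,
      accepts (l', [ffun=> v + d], m) r & v + d != c%:R].
    case: e => [] [/location_of_inj el ea ep eo elam el']; subst; rewrite cs in acc.
      move: sat; rewrite satisfies_guard /= => /lt_eqF->.
      by rewrite (reset_const _ false) in acc.
    move: sat; rewrite satisfies_guard /= => /gt_eqF->.
    by rewrite (reset_const _ false) in acc.
  by rewrite el' in acc'.
case=> [[o [t [[sat op [m' cs acc]] tb]]]|[-> -> neq acc]].
  exists (st t.2 (next_clock t (v + d)) m'); split=> //; split=> //.
  exists t.1.1, o, (if t.1.2 then [set: 'I_1] else set0); split=> //.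
  - by apply/edgesP; left; exists l, a, o, t.
  - by rewrite delayed_const.
  - by rewrite delayed_const reset_const.
exists (st Acc (v + d) m); split=> //; split=> //.
case/orP: (lt_total neq) => cmp.
  exists (guard CLt c), Noop, set0; split=> //.
  - by apply/edgesP; right; left.
  - by rewrite delayed_const satisfies_guard.
  - by rewrite delayed_const (reset_const _ false).
exists (guard CGt c), Noop, set0; split=> //.
- by apply/edgesP; right; right.
- by rewrite delayed_const satisfies_guard.
- by rewrite delayed_const (reset_const _ false).
Qed.

Notation bad_go := (@bad_go R S c).
Notation bad_successor := (@bad_successor R S).
Notation bad_letter := (@bad_letter R S).
Notation bad_tail := (@bad_tail R S).
Notation bad_word := (@bad_word R S c).

Definition enabled (o : counter_op) (m : nat) : bool :=
  match o with Pop => (0 < m)%N | Empty => m == 0%N | _ => true end.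

Lemma counter_stepP a o m : op_of a o ->
  (exists2 m', counter_step o m m' & m' = height a m) <-> enabled o m.
Proof.
rewrite /op_of /height; case: class_of; case: o => //= _; split=> //.
- by move=> _; exists m.
- by move=> _; exists m.+1.
- by case=> m' [].
- by move=> m_gt0; exists m.-1.
- by case=> m' [->].
- by move=> /eqP->; exists 0%N.
Qed.

Lemma counter_step_height a o m m' : op_of a o -> counter_step o m m' ->
  m' = height a m.
Proof.
rewrite /op_of /height; case: class_of; case: o => //= _; first by case.
by case=> -> ->.
Qed.

(** The counter never blocks a letter: a return can pop above [0] and pass the zero test at [0]. *)
Lemma op_exists a m : exists2 o, op_of a o & enabled o m.
Proof.
rewrite /op_of; case: class_of; [by exists Noop|by exists Push|].
by case: m => [|m]; [exists Empty|exists Pop].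
Qed.

Definition nonneg (r : word) := all (fun p : Gamma * R => 0 <= p.2) r.

Definition takes l v m a r o (t : branch) :=
  [/\ op_of a o, enabled o m, t \in branches l a o,
      satisfies ([ffun=> v] : valuation R 'I_1) t.1.1 &
      accepts (st t.2 (next_clock t v) (height a m)) r].

Lemma accepts_takes l v m a d r : 0 <= d ->
  accepts (st l v m) ((a, d) :: r) <->
  (exists o t, takes l (v + d) m a r o t) \/
  [/\ l = Timer, a = go S, v + d != c%:R & accepts (st Acc (v + d) m) r].
Proof.
move=> /accepts_step->; split=> -[]; auto; case=> o [t].
  case=> -[sat op [m' cs acc] tb]; left; exists o, t.
  have em := counter_step_height op cs; subst m'; split=> //.
  by apply/(counter_stepP _ op); exists (height a m).
case=> op /(counter_stepP _ op)[m' cs em] tb sat acc; left; exists o, t.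
by split=> //; split=> //; exists m' => //; rewrite em.
Qed.

Lemma accepts_Acc v m r : nonneg r -> accepts (st Acc v m) r.
Proof.
elim: r v m => [|[a d] r IH] v m /=.
  by move=> _; apply/accepts_nil; rewrite !inE eqxx.
case/andP=> d_ge0 /IH acc; apply/accepts_takes => //; left.
have [o opa en] := op_exists a m.
by exists o, ([::], false, Acc); split=> //; rewrite inE.
Qed.

Lemma accepts_End v m r : nonneg r -> accepts (st End v m) r <-> r = [::].
Proof.
case: r => [|[a d] r] /=.
  by split=> // _; apply/accepts_nil; rewrite !inE eqxx orbT.
by case/andP=> d_ge0 _; split=> // /(accepts_takes _ _ _ _ _ d_ge0)[[o [t []]]|[]].
Qed.

Lemma not_final l v m : l <> Acc -> l <> End -> ~ accepts (st l v m) [::].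
Proof.
move=> nacc nend /accepts_nil; rewrite /= !inE => /orP[] /eqP/location_of_inj //.
Qed.

Lemma accepts_Timer v m r : nonneg r -> accepts (st Timer v m) r <-> bad_go v r.
Proof.
elim: r v m => [|[a d] r IH] v m /=; first by split=> // /not_final[].
case/andP=> d_ge0 nnr; split=> [/(accepts_takes _ _ _ _ _ d_ge0)|].
  case=> [[o [t [_ _ + _]]]|[_ -> -> _]]; last by rewrite eqxx.
  by rewrite inE => /eqP-> /(IH _ _ nnr)->; rewrite orbT.
case/orP=> [/andP[/eqP-> neq]|bad]; apply/accepts_takes => //.
  by right; split=> //; exact: accepts_Acc.
have [o opa en] := op_exists a m.
by left; exists o, ([::], false, Timer); split=> //; apply/IH.
Qed.

Lemma accepts_Wait q a v m r : nonneg r ->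
  accepts (st (Wait q a) v m) r <-> (r != [::]) && bad_successor (allowed q a) v r.
Proof.
elim: r v m => [|[b d] r IH] v m /=; first by split=> // /not_final[].
case/andP=> d_ge0 nnr; split=> [/(accepts_takes _ _ _ _ _ d_ge0)|].
  case=> [[o [t [_ _]]]|[//]]; rewrite mem_cat !inE.
  case/orP=> [/or3P[/eqP->|/eqP->|/eqP->]|].
  - by rewrite satisfies_guard /= => -> /(IH _ _ nnr)/andP[].
  - by rewrite satisfies_guard /= => -> /(accepts_End _ _ nnr)->.
  - by rewrite satisfies_guard /= => lt1 _; rewrite ltNge (ltW lt1) gt_eqF.
  - case: ifP => // nall; rewrite inE => /eqP->.
    by rewrite satisfies_guard /= => /eqP-> _; rewrite ltxx eqxx.
have [o opa en] := op_exists b m.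
case: ltgtP => [lt1|gt1|eq1] bad; apply/accepts_takes => //; left; exists o.
(* The last letter must lead to [End], since [Wait] is not accepting. *)
- case: (eqVneq r [::]) => [->|rn].
    exists (guard CLt 1, false, End); split=> //.
      by rewrite satisfies_guard.
    exact/accepts_End.
  exists (guard CLt 1, false, Wait q a); split=> //; first by rewrite mem_head.
    by rewrite satisfies_guard.
  by apply/IH => //; rewrite rn.
- exists (guard CGt 1, false, Acc); split=> //.
    by rewrite satisfies_guard.
  exact: accepts_Acc.
- exists (guard CEq 1, false, Acc); split=> //.
  + by rewrite mem_cat (negbTE bad) mem_head orbT.
  + by rewrite satisfies_guard /= eq1.
  + exact: accepts_Acc.
Qed.

Definition next_bad (B : mode S -> nat -> word -> Prop) q m a r :=
  if next_mode q a is Some q' then B q' (height a m) r else True.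

(** Shared by [Main] and [Ini]: the run either guesses that the letter just read is bad or passes to
    the next mode. *)
Lemma letter_branchesP q v m a r : nonneg r ->
  (exists o t, [/\ op_of a o, enabled o m, t \in letter_branches q a o,
      satisfies ([ffun=> v] : valuation R 'I_1) t.1.1 &
      accepts (st t.2 (next_clock t v) (height a m)) r]) <->
  (bad_letter q m a r \/
   next_bad (fun q' m' r' => accepts (st (Main q') 0 m') r') q m a r).
Proof.
move=> nnr; split.
  case=> o [t [opa en + _]]; rewrite mem_cat /bad_letter => /orP[].
    case: (boolP (is_return a)) => reta.
      case: eqP en => [->|//] /= m0 _ _; by left.
    rewrite !inE => /orP[] /eqP-> /=.
      by move/(accepts_Wait _ _ _ _ nnr)/andP=> [_]; left.
    by move/(accepts_End _ _ nnr)->; left.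
  by rewrite inE => /eqP->; rewrite /next_bad; case: next_mode => [q'|] acc; right.
have [o opa en] := op_exists a m; case.
  rewrite /bad_letter; case: (boolP (is_return a)) => reta.
    move=> m0; exists Empty, ([::], false, Acc).
    move: reta; rewrite /letter_branches /is_return /op_of.
    by case: class_of => // _; split=> //; rewrite ?inE ?eqxx //; exact: accepts_Acc.
  move=> bad; exists o; case: (eqVneq r [::]) => [r0|rn].
    exists ([::], true, End); split=> //; last exact/accepts_End.
    by rewrite /letter_branches (negbTE reta) !inE eqxx orbT.
  exists ([::], true, Wait q a); split=> //; last by apply/accepts_Wait; rewrite // rn.
  by rewrite /letter_branches (negbTE reta) !inE eqxx.
rewrite /next_bad; case e: next_mode => [q'|] acc; exists o.
  exists ([::], true, Main q'); split=> //.
  by rewrite /letter_branches e mem_cat !inE eqxx orbT.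
exists ([::], false, Acc); split=> //; last exact: accepts_Acc.
by rewrite /letter_branches e mem_cat !inE eqxx orbT.
Qed.

Lemma accepts_Main q m r : nonneg r -> accepts (st (Main q) 0 m) r <-> bad_tail q m r.
Proof.
elim: r q m => [|[a d] r IH] q m /=; first by split=> // /not_final[].
case/andP=> d_ge0 nnr.
have nb : next_bad (fun q' m' r' => accepts (st (Main q') 0 m') r') q m a r <->
    is_true (if next_mode q a is Some q' then bad_tail q' (height a m) r else true).
  by rewrite /next_bad; case: next_mode => // q'; exact: IH.
split=> [/(accepts_takes _ _ _ _ _ d_ge0)|].
  case=> [[o [t [opa en + sat acc]]]|[//]]; rewrite inE => /orP[/eqP et|tb].
    by move: sat; rewrite et satisfies_guard /= add0r => ->.
  have /letter_branchesP : exists o t, [/\ op_of a o, enabled o m,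
      t \in letter_branches q a o,
      satisfies ([ffun=> 0 + d] : valuation R 'I_1) t.1.1 &
      accepts (st t.2 (next_clock t (0 + d)) (height a m)) r] by exists o, t.
  by case=> // [->|/nb->]; rewrite !orbT.
case/or3P=> [d0|bad|bad]; apply/accepts_takes => //; left.
- have [o opa en] := op_exists a m.
  exists o, (guard CEq 0, false, Acc); split=> //.
    by rewrite satisfies_guard /= add0r.
  exact: accepts_Acc.
- have [o [t [opa en tb sat acc]]] :=
    (letter_branchesP q (0 + d) m a nnr).2 (or_introl bad).
  by exists o, t; split=> //; rewrite inE tb orbT.
- have [o [t [opa en tb sat acc]]] :=
    (letter_branchesP q (0 + d) m a nnr).2 (or_intror (nb.2 bad)).
  by exists o, t; split=> //; rewrite inE tb orbT.
Qed.

Lemma accepts_Ini r : nonneg r -> accepts (st Ini 0 0) r <-> bad_word r.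
Proof.
case: r => [|[a d] r] /=; first by split=> // /not_final[].
case/andP=> d_ge0 nnr.
have nb : next_bad (fun q' m' r' => accepts (st (Main q') 0 m') r')
      (first_mode S) 0 a r <->
    is_true (if next_mode (first_mode S) a is Some q'
             then bad_tail q' (height a 0) r else true).
  by rewrite /next_bad; case: next_mode => // q'; exact: accepts_Main.
split=> [/(accepts_takes _ _ _ _ _ d_ge0)|].
  case=> [[o [t [opa en + sat acc]]]|[//]]; rewrite inE => /orP[/eqP et|tb].
    by move: acc; rewrite et => /(accepts_Timer _ _ nnr)->; rewrite !orbT.
  have /letter_branchesP : exists o t, [/\ op_of a o, enabled o 0,
      t \in letter_branches (first_mode S) a o,
      satisfies ([ffun=> 0 + d] : valuation R 'I_1) t.1.1 &
      accepts (st t.2 (next_clock t (0 + d)) (height a 0)) r] by exists o, t.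
  by case=> // [->|/nb->]; rewrite ?orbT.
case/or3P=> [bad|bad|bad]; apply/accepts_takes => //; left.
- have [o [t [opa en tb sat acc]]] :=
    (letter_branchesP (first_mode S) (0 + d) 0 a nnr).2 (or_introl bad).
  by exists o, t; split=> //; rewrite inE tb orbT.
- have [o [t [opa en tb sat acc]]] :=
    (letter_branchesP (first_mode S) (0 + d) 0 a nnr).2 (or_intror (nb.2 bad)).
  by exists o, t; split=> //; rewrite inE tb orbT.
- have [o opa en] := op_exists a 0.
  exists o, ([::], true, Timer); split=> //.
  exact/accepts_Timer.
Qed.

Lemma successful_bad_word r : nonneg r -> @successful R A r <-> bad_word r.
Proof.
move=> nnr; rewrite -(accepts_Ini nnr); split.
  case=> l0 [l [nu [m [/set1P-> acc r']]]].
  by exists (l, nu, m).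
case=> [[[l nu] m] [acc r']]; exists (location_of Ini), l, nu, m.
by split=> //; rewrite inE.
Qed.

End Runs.
End Automaton.

(** * Delays versus absolute times *)

Section DelaysAndTimes.
Local Open Scope ring_scope.
Variables (R : realType) (T : Type).
Implicit Types (r w : seq (T * R)).

Fixpoint delays_of (t : R) w : seq (T * R) :=
  if w is (a, u) :: w' then (a, u - t) :: delays_of u w' else [::].

Lemma zip_scanl_delays t w :
  zip (unzip1 (delays_of t w)) (scanl +%R t (unzip2 (delays_of t w))) = w.
Proof. by elim: w t => //= -[a u] w IH t /=; rewrite subrKC IH. Qed.

Lemma delays_zip_scanl t r :
  delays_of t (zip (unzip1 r) (scanl +%R t (unzip2 r))) = r.
Proof. by elim: r t => //= -[a d] r IH t /=; rewrite [t + d]addrC addrK addrC IH. Qed.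

End DelaysAndTimes.

Section Universality.
Local Open Scope ring_scope.
Variables (R : realType) (S : scheme) (N c : nat).
Hypothesis go_internal : class_of (go S) = Internal.
Hypothesis N_large : (nb_loc S <= N.+1)%N.

Lemma delays_of_nonneg (T : Type) (t : R) (w : seq (T * R)) :
  all (fun p => 0 <= p.2) (delays_of t w) = path <=%R t (unzip2 w).
Proof. by elim: w t => //= -[a u] w IH t /=; rewrite subr_ge0 IH. Qed.

Lemma run_nonneg (A : toca) s r s' : @run R A s r s' -> all (fun p => 0 <= p.2) r.
Proof.
elim=> [//|[[l nu] m] a d [[l1 nu1] m1] r1 s2 [d_ge0 _] _ IH] /=.
by rewrite d_ge0.
Qed.

Lemma sorted_nonneg_path (s : seq R) :
  path <=%R 0 s = all (fun t => 0 <= t) s && sorted <=%R s.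
Proof.
case: s => //= x s; rewrite andbAC -andbA; apply: andb_id2l => x_ge0.
apply/idP/andP=> [xs|[]//]; split=> //.
by apply: sub_all (order_path_min le_trans xs) => y; exact: le_trans.
Qed.

(** Delay sequences and timed words determine each other, so the runs on a timed word are exactly
    those on its delays. *)
Lemma universalP :
  universal R (automaton S N c) <->
  forall r : seq (letter S * R), r != [::] -> nonneg r -> bad_word c r.
Proof.
split=> [univ r rn nnr|bad].
  have tw : @timed_words R (letter S) (timed_word_of r).
    have dE : delays_of 0 (timed_word_of r) = r by exact: delays_zip_scanl.
    have : path <=%R 0 (unzip2 (timed_word_of r)) by rewrite -delays_of_nonneg dE.
    rewrite sorted_nonneg_path => /andP[ge0 srt]; split=> //.
    by apply: contraNneq rn => w0; rewrite -dE w0.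
  have [r' [_ succ eqw]] : @language R (automaton S N c) (timed_word_of r).
    by rewrite univ.
  have rr' : r' = r.
    by rewrite -(delays_zip_scanl 0 r') -(delays_zip_scanl 0 r); congr delays_of.
  by apply: (successful_bad_word c go_internal N_large nnr).1; rewrite -rr'.
apply/classical_sets.seteqP; split=> w.
  case=> r [rn [l0 [l [nu [m [_ _ /run_nonneg nnr]]]]] ->].
  have dE : delays_of 0 (timed_word_of r) = r by exact: delays_zip_scanl.
  have : path <=%R 0 (unzip2 (timed_word_of r)) by rewrite -delays_of_nonneg dE.
  rewrite sorted_nonneg_path => /andP[ge0 srt]; split=> //.
  by apply: contraNneq rn => w0; rewrite -dE w0.
case=> wn ge0 srt.
have nnr : nonneg (delays_of 0 w).
  by rewrite /nonneg delays_of_nonneg sorted_nonneg_path ge0.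
have rn : delays_of 0 w != [::] by case: w wn {ge0 srt nnr} => [|[]].
exists (delays_of 0 w); split=> //; last exact/esym/zip_scanl_delays.
by apply: (successful_bad_word c go_internal N_large nnr).2; exact: bad.
Qed.

End Universality.

(** * Valid words, position by position *)

Section Positions.
Local Open Scope ring_scope.
Variables (R : realType) (S : scheme) (c : nat).
Variables (a : nat -> letter S) (d : nat -> R).

(* The delay of position [0] is not counted. *)
Definition time (j : nat) : R := \sum_(k < j) d k.+1.

Definition segment (i m : nat) : seq (letter S * R) :=
  [seq (a k, d k) | k <- iota i m].

Fixpoint mode_at (j : nat) : mode S :=
  if j is j'.+1 then
    odflt (first_mode S) (next_mode (mode_at j') (a j'))
  else first_mode S.

Fixpoint height_at (j : nat) : nat :=
  if j is j'.+1 then height (a j') (height_at j') else 0.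

Lemma timeS j : time j.+1 = time j + d j.+1.
Proof. by rewrite /time big_ord_recr. Qed.

(** Times increase strictly, so a letter at time [t + 1] is the first one not before that time,
    which is where the scan stops. *)
Lemma bad_successorP (P : pred (letter S)) t i m :
  (forall k, (i < k <= i + m)%N -> 0 < d k) ->
  reflect (exists j, [/\ (i < j <= i + m)%N, time j = t + 1 & P (a j)])
          (~~ bad_successor P (time i - t) (segment i.+1 m)).
Proof.
elim: m i => [|m IH] i d_gt0 /=.
  by apply: (iffP idP) => // -[j []]; lia.
have mono k : (k <= m)%N -> time i + d i.+1 <= time (i + k).+1.
  elim: k => [|k IHk] ltk; first by rewrite addn0 timeS.
  apply: le_trans (IHk (ltnW ltk)) _.
  by rewrite addnS [X in _ <= X]timeS lerDl ltW // d_gt0 //; lia.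
have smono k : (0 < k <= m)%N -> time i + d i.+1 < time (i + k).+1.
  case: k => // k ltk; apply: le_lt_trans (mono k _) _; first by lia.
  by rewrite addnS [X in _ < X]timeS ltrDl d_gt0 //; lia.
rewrite addrAC -timeS; case: ltgtP => cmp.
- apply: (iffP (IH i.+1 _)) => [k ltk|[j [ltj tj Pj]]|[j [ltj tj Pj]]].
  + by apply: d_gt0; lia.
  + by exists j; split=> //; lia.
  + exists j; split=> //; suff : (j != i.+1)%N by lia.
    by apply/eqP => ej; move: tj cmp; rewrite ej => ->; lra.
- apply: (iffP idP) => // -[j [ltj tj Pj]].
  have := mono (j - i.+1)%N; rewrite -addSn subnKC; last by lia.
  by rewrite -timeS => /(_ _)-/(_ ltac:(lia)); rewrite tj; lra.
- rewrite negbK; apply: (iffP idP) => [Pa|[j [ltj tj Pj]]].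
    by exists i.+1; split=> //; [lia|lra].
  case: (eqVneq j i.+1) => [<- //|nj].
  have := smono (j - i.+1)%N; rewrite -addSn subnKC; last by lia.
  by rewrite -timeS => /(_ _)-/(_ ltac:(lia)); rewrite tj; lra.
Qed.

Lemma bad_goP i m :
  ~~ bad_go c (time i) (segment i.+1 m) <->
  (forall j, (i < j <= i + m)%N -> a j = go S -> time j = c%:R).
Proof.
elim: m i => [|m IH] i /=; first by split=> // _ j; lia.
rewrite -timeS negb_or negb_and negbK; split=> [/andP[ti /IH tj] j ltj aj|tj].
  case: (eqVneq j i.+1) => [ej|nj]; last by apply: tj => //; lia.
  by move: ti; rewrite -ej aj eqxx => /eqP.
apply/andP; split; last by apply/IH => j ltj; apply: tj; lia.
by case: eqP => //= ai; apply/eqP/tj => //; lia.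
Qed.

Lemma bad_tailP i m :
  ~~ bad_tail (mode_at i) (height_at i) (segment i m) <->
  (forall j, (i <= j < i + m)%N ->
     [/\ d j != 0, next_mode (mode_at j) (a j) &
         ~~ bad_letter (mode_at j) (height_at j) (a j)
              (segment j.+1 (i + m - j.+1))]).
Proof.
elim: m i => [|m IH] i /=; first by split=> // _ j; lia.
have := IH i.+1 => /=; case e: next_mode => [q|] /= {}IH.
  rewrite 2!negb_or; split=> [/and3P[di bi /IH bt] j ltj|good].
    case: (eqVneq j i) => [->|nj].
      by rewrite e; split=> //; rewrite addnS subSS addKn.
    by rewrite addnS -addSn; apply: bt; lia.
  have [di _ bi] := good i ltac:(lia).
  rewrite addnS subSS addKn in bi; rewrite di bi /=.
  by apply/IH => j ltj; have := good j; rewrite addnS -addSn; apply; lia.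
rewrite 2!orbT; split=> // /(_ i)[]; first by lia.
by rewrite e.
Qed.

Record valid (n : nat) : Prop := Valid {
  valid_delay : forall j, (0 < j < n)%N -> 0 < d j;
  valid_mode : forall j, (j < n)%N -> next_mode (mode_at j) (a j);
  valid_height : forall j, (j < n)%N -> is_return (a j) -> (0 < height_at j)%N;
  valid_successor : forall j, (j < n)%N -> ~~ is_return (a j) ->
    exists k, [/\ (j < k < n)%N, time k = time j + 1
                & allowed (mode_at j) (a j) (a k)];
  valid_go : forall j, (0 < j < n)%N -> a j = go S -> time j = c%:R
}.

Lemma bad_letterP n j : (j < n)%N -> (forall k, (0 < k < n)%N -> 0 < d k) ->
  ~~ bad_letter (mode_at j) (height_at j) (a j) (segment j.+1 (n - j.+1)) <->
  (is_return (a j) -> (0 < height_at j)%N) /\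
  (~~ is_return (a j) -> exists k, [/\ (j < k < n)%N, time k = time j + 1
                & allowed (mode_at j) (a j) (a k)]).
Proof.
move=> ltj d_gt0; rewrite /bad_letter; case: ifP => ra.
  by rewrite -lt0n; split=> [h|[h _]]; [split|apply: h].
rewrite -(subrr (time j)).
split=> [/bad_successorP[k ltk|k [ltk tk ak]]|[_ /(_ isT)[k [ltk tk ak]]]].
- by apply: d_gt0; lia.
- by split=> // _; exists k; split=> //; lia.
apply/bad_successorP => [i lti|]; first by apply: d_gt0; lia.
by exists k; split=> //; lia.
Qed.

Lemma validP n : (forall j, (0 <= d j)) -> (0 < n)%N ->
  ~~ bad_word c (segment 0 n) <-> valid n.
Proof.
case: n => // n d_ge0 _ /=.
have t0 : time 0 = 0 by rewrite /time big_ord0.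
have := bad_goP 0 n; rewrite t0 add0n => goP.
have := bad_tailP 1 n => /= tailP.
have letP := @bad_letterP n.+1.
split.
  rewrite 2!negb_or => /and3P[b0 bt /goP bg].
  have e : next_mode (first_mode S) (a 0) by case: next_mode bt.
  have {}bt : ~~ bad_tail (odflt (first_mode S) (next_mode (first_mode S) (a 0)))
      (height (a 0) 0) (segment 1 n) by case: next_mode bt e.
  move/tailP: bt => bt.
  have d_gt0 j : (0 < j < n.+1)%N -> 0 < d j.
    by move=> ltj; rewrite lt_neqAle d_ge0 eq_sym andbT; case: (bt j) => //; lia.
  have lj j : (j < n.+1)%N ->
      ~~ bad_letter (mode_at j) (height_at j) (a j) (segment j.+1 (n.+1 - j.+1)).
    case: j => [_|j ltj]; first by rewrite subSS subn0.
    by case: (bt j.+1) => //; lia.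
  split; first exact: d_gt0.
  - by case=> [//|j ltj]; case: (bt j.+1) => //; lia.
  - by move=> j ltj; case: (letP j ltj d_gt0).1 => //; exact: lj.
  - by move=> j ltj; case: (letP j ltj d_gt0).1 => //; exact: lj.
  - by move=> j ltj; apply: bg; lia.
case=> d_gt0 vm vh vs vg; rewrite 2!negb_or; apply/and3P; split.
- have := (letP 0 isT d_gt0).2; rewrite subSS subn0; apply; split; first exact: vh.
  exact: vs.
- have := vm 0 isT => /=; case e: next_mode => [q|] // _.
  rewrite e /= in tailP; apply/tailP => j ltj; split.
  + by rewrite gt_eqF // d_gt0 //; lia.
  + by apply: vm; lia.
  + by apply/letP => //; [lia|split; [apply: vh; lia|apply: vs; lia]].
- by apply/goP => j ltj; apply: vg; lia.
Qed.

End Positions.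

(** * Valid words encode halting computations *)

Lemma threshold (p : pred nat) n :
  (forall i j, i <= j < n -> p j -> p i) ->
  exists2 N, N <= n & forall j, j < n -> p j = (j < N).
Proof.
elim: n => [|n IH] mono; first by exists 0.
have [|N leN pN] := IH; first by move=> i j ltj; apply: mono; lia.
case: (boolP (p n)) => pn.
  by exists n.+1 => // j ltj; rewrite ltj; apply: mono pn; lia.
exists N; first by lia.
move=> j; rewrite ltnS leq_eqVlt => /orP[/eqP->|]; last exact: pN.
by rewrite (negbTE pn); lia.
Qed.

Lemma replace_first_notin (T : eqType) (a b : T) w :
  a \notin w -> replace_first a b w = w.
Proof.
by elim: w => //= c w IH; rewrite inE negb_or eq_sym => /andP[/negbTE-> /IH->].
Qed.

Lemma nth_replace_first (T : eqType) (x0 a b : T) w i : i < size w ->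
  nth x0 (replace_first a b w) i =
  if a \in take i w then nth x0 w i
  else if nth x0 w i == a then b else nth x0 w i.
Proof.
elim: w i => //= c w IH [|i] /=; first by case: (eqVneq c a).
by rewrite ltnS inE [a == c]eq_sym => lti; case: (c == a) => //=; exact: IH.
Qed.

Section Words.
Variables (R : realType) (K : nat) (L : finType) (code : L -> instr K L).
Variables (init start halt : L) (kin : kind K).
Hypothesis code_init : code init = (pad K, kin, init, init).
Hypothesis init_neq_halt : init != halt.

(** [LGo] is the outermost [None] and therefore has rank [0], the number written in
    [go_edge_number]. *)
Definition token_letter : finType :=
  option (option (option (option (option (kind K))))).
Definition LGo : token_letter := None.
Definition LStart : token_letter := Some None.
Definition LPad : token_letter := Some (Some None).
Definition LRet : token_letter := Some (Some (Some None)).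
Definition LMark : token_letter := Some (Some (Some (Some None))).
Definition LTok (t : kind K) : token_letter := Some (Some (Some (Some (Some t)))).

Definition token_class (a : token_letter) : letter_class :=
  match a with
  | Some None | Some (Some None) => Call
  | Some (Some (Some None)) => Return
  | _ => Internal
  end.

Definition token_of (a : token_letter) : option (kind K) :=
  match a with
  | Some (Some None) => Some (pad K)
  | Some (Some (Some (Some (Some t)))) => Some t
  | _ => None
  end.

Definition token_mode : finType := option (option (bool * L * bool)).
Definition MStart : token_mode := None.
Definition MEnd : token_mode := Some None.
(* The current label, whether the first block is being read, and whether the
   instruction has already found its token in the current block. *)
Definition MRun (first : bool) (l : L) (found : bool) : token_mode :=
  Some (Some (first, l, found)).

Definition source (l : L) : kind K := (code l).1.1.1.
Definition target (l : L) : kind K := (code l).1.1.2.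
Definition next_label (l : L) (found : bool) : L :=
  if found then (code l).1.2 else (code l).2.

Definition token_next (q : token_mode) (a : token_letter) : option token_mode :=
  match q with
  | None => if a == LStart then Some (MRun true init false) else None
  | Some None => if a == LRet then Some MEnd else None
  | Some (Some (first, l, found)) =>
      match a with
      | None => Some (MRun false (if found then start else init) false)
      | Some None => None
      | Some (Some None) =>
          if first then Some (MRun true l (found || (pad K == source l))) else None
      | Some (Some (Some None)) => Some MEnd
      | Some (Some (Some (Some None))) => Some (MRun false (next_label l found) false)
      | Some (Some (Some (Some (Some t)))) =>
          Some (MRun false l (found || (t == source l)))
      end
  end.

Definition found_in (q : token_mode) : bool :=
  if q is Some (Some (_, _, found)) then found else false.

(** The label is that of the mode after [a], so a marker already belongs to its own configuration.
    Tokens are copied except for the first source token, a marker becomes a marker, or [LGo] while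
    loading, and letters of a halting configuration become returns. *)
Definition token_allowed (q : token_mode) (a b : token_letter) : bool :=
  if token_next q a is Some (Some (Some (_, l, _))) then
    if l == halt then b == LRet
    else match token_of a with
         | Some t =>
             b == LTok (if found_in q then t
                        else if t == source l then target l else t)
         | None => (b == LMark) || ((l == init) && (b == LGo))
         end
  else false.

Definition token_scheme : scheme := {|
  letter := token_letter;
  mode := token_mode;
  class_of := token_class;
  next_mode := token_next;
  first_mode := MStart;
  allowed := token_allowed;
  go := LGo
|}.

Lemma stepE l w :
  step code (l, w) =
    (next_label l (source l \in w), replace_first (source l) (target l) w).
Proof.
rewrite /step /next_label /source /target /=; case: (code l) => [[[t t'] l1] l2] /=.
by case: ifP => // /negbT/replace_first_notin->.
Qed.

Definition runs (q : token_mode) l found := exists first, q = MRun first l found.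

Lemma next_token q l found a t : runs q l found -> token_of a = Some t ->
  token_next q a ->
  exists2 q', token_next q a = Some q' & runs q' l (found || (t == source l)).
Proof.
case=> first ->; case: a => [[[[[u|]|]|]|]|] //= [<-].
  by move=> _; eexists => //; exists false.
by case: first => // _; eexists => //; exists true.
Qed.

Lemma allowed_token q l found a t b : runs q l found -> token_of a = Some t ->
  token_allowed q a b -> l != halt ->
  b = LTok (if found then t else if t == source l then target l else t).
Proof.
rewrite /token_allowed => rq ta; case e: (token_next q a) => [q1|] //.
have [|q' eq' [first' eq1]] := next_token rq ta; first by rewrite e.
move: e eq'; rewrite eq1 => -> [->] /=; rewrite ta.
case: rq => first -> /=.
by case: eqP => // _ /eqP.
Qed.

Lemma allowed_not_call q a b : token_allowed q a b -> token_class b <> Call.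
Proof.
rewrite /token_allowed; case: token_next => // -[] // -[] // [[_ l] _].
case: eqP => _; first by move/eqP->.
by case: token_of => [t /eqP->|/orP[/eqP->|/andP[_ /eqP->]]].
Qed.

(** Used to show that calls come first, then internal letters, then returns. *)
Definition phase (q : token_mode) : nat :=
  match q with
  | None => 0
  | Some None => 2
  | Some (Some (first, _, _)) => if first then 0 else 1
  end.

Definition class_phase (a : token_letter) : nat :=
  match token_class a with Call => 0 | Internal => 1 | Return => 2 end.

Lemma next_phase q a q' : token_next q a = Some q' ->
  phase q <= class_phase a /\ phase q' = class_phase a.
Proof.
case: q => [[[[[] l] found]|]|]; case: a => [[[[[u|]|]|]|]|] //=; by case=> <-.
Qed.

Lemma next_not_start q a q' : token_next q a = Some q' -> q' <> MStart.
Proof.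
case: q => [[[[[] l] found]|]|]; case: a => [[[[[u|]|]|]|]|] //=; by case=> <-.
Qed.

Lemma next_start q a q' : q <> MStart -> token_class a = Call ->
  token_next q a = Some q' -> a = LPad.
Proof. by case: q => [[[[[] l] found]|]|] //; case: a => [[[[[u|]|]|]|]|]. Qed.

Lemma conf_init x m k : k < x -> (conf code init start x m k).1 = init.
Proof.
elim: k => //= k IH ltk; rewrite ltn_eqF //=.
by rewrite /step IH ?code_init 1?ltnW //; case: ifP.
Qed.

(** * From a valid word to a halting computation *)

Section ValidToHalting.
Variables (x n : nat) (a : nat -> token_letter) (d : nat -> R).
Hypothesis x_gt0 : 0 < x.
Hypothesis n_gt0 : 0 < n.
Hypothesis valid_a : @valid R token_scheme x a d n.
Local Notation time := (time d).
Local Notation mode_at := (@mode_at token_scheme a).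
Local Notation height_at := (@height_at token_scheme a).

Let next_some j : j < n -> token_next (mode_at j) (a j) = Some (mode_at j.+1).
Proof.
by move=> ltj; have /= := valid_mode valid_a ltj; case: token_next.
Qed.

Let a0 : a 0 = LStart.
Proof. by have /= := valid_mode valid_a n_gt0; case: eqP. Qed.

Lemma class_phase_mono i j : i <= j < n -> class_phase (a i) <= class_phase (a j).
Proof.
elim: j => [|j IH] ltj; first by have -> : i = 0 by lia.
case: (eqVneq i j.+1) => [->//|ni].
apply: leq_trans (IH _) _; first by lia.
have [|_ <-] := next_phase (next_some (_ : j < n)); first by lia.
by have [|h _] := next_phase (next_some (_ : j.+1 < n)); first by lia.
Qed.

(* The word consists of [N] calls, [M - N] internal letters and the returns. *)
Lemma word_shape : exists N M, [/\ 0 < N <= M, M <= n, n <= M + N,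
  forall j, j < n -> (token_class (a j) = Call <-> j < N) &
  forall j, j < n -> is_return (S := token_scheme) (a j) = (M <= j)].
Proof.
have [|N leN pN] := @threshold (fun j => class_phase (a j) < 1) n.
  by move=> i j /class_phase_mono; lia.
have [|M leM pM] := @threshold (fun j => class_phase (a j) < 2) n.
  by move=> i j /class_phase_mono; lia.
have callN j : j < n -> (token_class (a j) = Call <-> j < N).
  by move=> /pN <-; rewrite /class_phase; case: token_class.
have retM j : j < n -> is_return (S := token_scheme) (a j) = (M <= j).
  move=> /pM; rewrite [M <= j]leqNgt => <-.
  by rewrite /class_phase /is_return /=; case: token_class.
have N_gt0 : 0 < N by apply/(callN 0 n_gt0); rewrite a0.
have leNM : N <= M.
  case: N leN pN {callN N_gt0} => // N leN pN.
  by have := pN N leN; have := pM N leN; rewrite ltnSn; lia.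
have hN j : j <= N -> height_at j = j.
  elim: j => //= j IH ltj; rewrite IH ?(ltnW ltj) // /height /=.
  by have /callN[_ /(_ ltj)->] : j < n by lia.
have hM j : N <= j <= M -> height_at j = N.
  elim: j => [|j IH] ltj; first by rewrite hN; lia.
  case: (eqVneq j.+1 N) => [ej|nj]; first by rewrite hN; lia.
  have ltjn : j < n by lia.
  rewrite /= IH; last by lia.
  rewrite /height /=; have := retM j ltjn; have := callN j ltjn; rewrite /is_return /=.
  by case: token_class => //; [case=> /(_ erefl)|]; lia.
have hR j : M <= j <= n -> height_at j = N - (j - M).
  elim: j => [|j IH] ltj; first by rewrite hM; lia.
  case: (eqVneq j.+1 M) => [ej|nj]; first by rewrite hM; lia.
  have ltjn : j < n by lia.
  rewrite /= IH; last by lia.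
  rewrite /height /=; have := retM j ltjn; rewrite /is_return /=.
  by case: token_class => //; lia.
exists N, M; split=> //; first by rewrite N_gt0.
case: (eqVneq M n) => [|nM]; first by lia.
(* The last letter is a return read at positive height; heights fall from [N] by one per return, so
   there are at most [N] returns. *)
have ltn : n.-1 < n by lia.
have /= := valid_height valid_a ltn; rewrite retM // hR; last by lia.
by move=> /(_ ltac:(lia)); lia.
Qed.

Lemma time_mono i j : i < j < n -> (time i < time j)%R.
Proof.
elim: j => // j IH ltj; have dj : (0 < d j.+1)%R by apply: (valid_delay valid_a); lia.
case: (eqVneq i j) => [->|nij]; first by rewrite timeS ltrDl.
by apply: lt_le_trans (IH _) _; [lia|rewrite timeS lerDl ltW].
Qed.

Lemma time_mono_inv i j : i < n -> j < n -> (time i < time j)%R -> i < j.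
Proof.
move=> lti ltj; apply: contraTT; rewrite -leqNgt leq_eqVlt -leNgt => /orP[/eqP->//|ltji].
by rewrite ltW // time_mono //; lia.
Qed.

(** The successor map is strictly increasing on the [M] letters that are not returns, and its values
    lie among the [n - N <= M] positions after the calls. This leaves no room for a gap, that is,
    for an inserted letter. *)
Lemma successor_shift N M : 0 < N <= M -> M <= n -> n <= M + N ->
  (forall j, j < n -> (token_class (a j) = Call <-> j < N)) ->
  (forall j, j < n -> is_return (S := token_scheme) (a j) = (M <= j)) ->
  forall j, j < M -> [/\ N + j < n, time (N + j) = (time j + 1)%R &
                         token_allowed (mode_at j) (a j) (a (N + j))].
Proof.
move=> N_gt0 leM len callN retM.
have succ j : j < M -> exists k, [/\ j < k < n, time k = (time j + 1)%R
                & token_allowed (mode_at j) (a j) (a k)].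
  move=> ltj; have ltjn : j < n by lia.
  by apply: (valid_successor valid_a ltjn); rewrite retM // -ltnNge.
(* From the left: the successor of letter [0] is not a call, so it is at [N] or later. *)
have lower j k : j < M -> k < n -> time k = (time j + 1)%R ->
    token_allowed (mode_at j) (a j) (a k) -> N + j <= k.
  elim: j k => [|j IH] k ltj ltk tk ak.
    rewrite addn0 leqNgt; apply/negP => /(callN k ltk).
    exact: allowed_not_call ak.
  have [|k' [ltk' tk' ak']] := succ j; first by lia.
  have := IH k' ltac:(lia) ltac:(lia) tk' ak'.
  suff : k' < k by lia.
  apply: time_mono_inv => //; first by lia.
  by rewrite tk tk' ltrD2r time_mono //; lia.
(* From the right: the successor of letter [M.-1] is in the word, hence before position [M + N]. *)
have upper i j k : i + j.+1 = M -> k < n -> time k = (time j + 1)%R -> k <= N + j.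
  elim: i j k => [|i IH] j k ij ltk tk; first by lia.
  have [|k' [ltk' tk' ak']] := succ j.+1; first by lia.
  have := IH j.+1 k' ltac:(lia) ltac:(lia) tk'.
  suff : k < k' by lia.
  apply: time_mono_inv => //; first by lia.
  by rewrite tk tk' ltrD2r time_mono //; lia.
move=> j ltj; have [k [ltk tk ak]] := succ j ltj.
have := lower j k ltj ltac:(lia) tk ak.
have := upper (M - j.+1) j k ltac:(lia) ltac:(lia) tk.
move=> le1 le2; have -> : N + j = k by lia.
by split=> //; lia.
Qed.

Section Blocks.
Variables N M : nat.
Hypotheses (N_gt0 : 0 < N) (leNM : N <= M) (leMn : M <= n).
Hypothesis callN : forall j, j < n -> (token_class (a j) = Call <-> j < N).
Hypothesis retM : forall j, j < n -> is_return (S := token_scheme) (a j) = (M <= j).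
Hypothesis shift : forall j, j < M ->
  [/\ N + j < n, time (N + j) = (time j + 1)%R &
      token_allowed (mode_at j) (a j) (a (N + j))].

(** A marker followed by the string [w]. The bound [k.+1 * N <= M] places the block before the
    returns, so that all its letters have successors. *)
Definition block k l w :=
  [/\ k.+1 * N <= M, size w = N.-1, token_of (a (k * N)) = None,
      runs (mode_at (k * N).+1) l false &
      forall i, i < N.-1 -> token_of (a (k * N + i.+1)) = Some (nth (pad K) w i)].

Lemma block_mode k l w i : block k l w -> i <= N.-1 ->
  runs (mode_at (k * N + i.+1)) l (source l \in take i w).
Proof.
case=> leM sw _ r0 tw; elim: i => [|i IH] lti; first by rewrite take0 addn1.
have ltj : k * N + i.+1 < n by rewrite mulSn in leM; lia.
have [|q' eq' rq'] := next_token (IH (ltnW lti)) (tw i lti).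
  by rewrite next_some.
rewrite next_some // in eq'; case: eq' => <- in rq'.
rewrite addnS (take_nth (pad K)) ?sw // mem_rcons inE orbC [source l == _]eq_sym.
exact: rq'.
Qed.

Lemma block_next k l w : block k l w -> l != halt ->
  let w' := replace_first (source l) (target l) w in
  (a (k.+1 * N) = LMark /\ block k.+1 (next_label l (source l \in w)) w') \/
  [/\ a (k.+1 * N) = LGo, l = init &
      block k.+1 (if source l \in w then start else init) w'].
Proof.
move=> bk nh w'; have := bk; case=> leM sw mk r0 tw.
have leM' := leM; rewrite mulSn in leM'.
have tok i : i < N.-1 -> a (k.+1 * N + i.+1) = LTok (nth (pad K) w' i).
  move=> lti; have [|ltn _ al] := shift (_ : k * N + i.+1 < M); first by lia.
  rewrite mulSn -addnA (allowed_token (block_mode bk (ltnW lti)) (tw i lti) al nh).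
  by rewrite nth_replace_first ?sw.
have [|ltn _ al] := shift (_ : k * N < M); first by lia.
have am : a (k.+1 * N) = LMark \/ a (k.+1 * N) = LGo /\ l = init.
  move: al; rewrite -mulSn /token_allowed next_some; last by lia.
  case: r0 => first ->; rewrite /MRun mk (negbTE nh).
  by case/orP=> [/eqP|/andP[/eqP-> /eqP]]; auto.
(* The next block ends before the returns too: otherwise position [M], which carries a return, would
   lie in it, among markers and tokens. *)
have leM2 : k.+2 * N <= M.
  rewrite leqNgt; apply/negP => ltM.
  have ltj : k.+2 * N.-1.+1 = k.+2 * N by rewrite prednK.
  have := @shift (M.-1) ltac:(lia); case=> ltM' _ _.
  have jn : M < n by lia.
  have := retM jn; rewrite leqnn.
  have [j ltj' eM] : exists2 j, j < N & M = k.+1 * N + j.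
    by exists (M - k.+1 * N); rewrite 2?mulSn in ltM *; lia.
  case: j ltj' eM => [|j] ltj' ->; first by rewrite addn0; case: am => [->|[->]].
  by rewrite tok //; lia.
have fin l' : runs (mode_at (k.+1 * N).+1) l' false -> block k.+1 l' w'.
  split=> //; first by rewrite size_replace_first.
    by case: am => [->|[->]].
  by move=> i /tok->.
have rl : runs (mode_at (k.+1 * N)) l (source l \in w).
  have := block_mode bk (leqnn _); rewrite -sw take_size sw.
  by congr runs; congr mode_at; rewrite mulSn; lia.
have ltkn : k.+1 * N < n by rewrite [k.+2 * N]mulSn in leM2; lia.
have nx := next_some ltkn.
case: rl => first eq; rewrite eq in nx; case: am => [am|[am el]]; rewrite am in nx.
  by left; split=> //; apply: fin; exists false; exact: esym (Some_inj nx).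
by right; split=> //; apply: fin; exists false; exact: esym (Some_inj nx).
Qed.

Lemma words_halt : exists k, (conf code init start x N.-1 k).1 = halt.
Proof.
(* Without halting the blocks would go on forever, against the length of the word. *)
set m := N.-1; apply: contrapT => nohalt.
have neq k : (conf code init start x m k).1 != halt.
  by apply/eqP => e; apply: nohalt; exists k.
have timek j : j * N < M -> time (j * N) = (j%:R)%R.
  elim: j => [|j IH] ltj; first by rewrite mul0n /time big_ord0.
  rewrite mulSn in ltj *; have [|_ -> _] := @shift (j * N); first by lia.
  by rewrite IH ?natr1 //; lia.
(* The second alternative is a word that did not use [LGo] at time [x]: it keeps loading, and [init]
   is not halting. *)
have inv k : exists l w, block k l w /\
    ((l, w) = conf code init start x m k \/ x <= k /\ l = init).
  elim: k => [|k [l [w [bk cw]]]].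
    exists init, (nseq m (pad K)); split; last by left.
    split; rewrite ?mul1n ?mul0n ?size_nseq ?a0 //; first by exists true; rewrite /= a0.
    move=> i lti; rewrite add0n nth_nseq lti.
    have ltj : i.+1 < n by lia.
    have ci : token_class (a i.+1) = Call by apply/callN => //; lia.
    have ltj' : i < n by lia.
    by rewrite (next_start (next_not_start (next_some ltj')) ci (next_some ltj)).
  have nl : l != halt.
    case: cw => [cw|[_ -> //]].
    by have := neq k; rewrite -cw.
  have kM : k * N < M by case: bk => leM _ _ _ _; rewrite mulSn in leM; lia.
  have tk : time (k.+1 * N) = (k.+1%:R)%R.
    by have [_ -> _] := shift kM; rewrite timek // natr1.
  have ltk : k.+1 * N < n by have [ltn _ _] := shift kM; rewrite mulSn.
  have := block_next bk nl; case=> [[am bk']|[ag el bk']].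
    eexists; eexists; split; first exact: bk'.
    rewrite -stepE.
    case: cw => [cw|[lexk el]]; last first.
      by right; rewrite el /next_label code_init; split; [lia|case: ifP].
    rewrite /= -cw /=; case: ifP => [/andP[/eqP ex pw]|_]; last by left.
    right; split; first by lia.
    have el : l = init by have := @conf_init x m k; rewrite -cw; apply; lia.
    by rewrite el /next_label code_init; case: ifP.
  (* Block [k.+1] begins at time [k.+1], and [LGo] may only occur at time [x]. *)
  have ex : k.+1 = x.
    have k_gt0 : 0 < k.+1 * N < n by rewrite ltk muln_gt0 N_gt0.
    have := valid_go valid_a k_gt0 ag; rewrite tk => /eqP.
    by rewrite eqr_nat => /eqP.
  have {}cw : (l, w) = conf code init start x m k by case: cw => // -[]; lia.
  rewrite el in bk' cw *.
  have src : source init = pad K by rewrite /source code_init.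
  (* Without padding, [LGo] leaves the label at [init], in agreement with [conf]. *)
  exists (if pad K \in w then start else init), (replace_first (pad K) kin w).
  have trg : target init = kin by rewrite /target code_init.
  rewrite src trg in bk'; split=> //; left.
  rewrite /= -cw /= ex eqxx /= stepE src trg /next_label code_init.
  by case: ifP.
have [l [w [[leM _ _ _ _] _]]] := inv n.
have := leq_pmulr n.+1 N_gt0; lia.
Qed.

End Blocks.

Lemma valid_halts : exists m k, (conf code init start x m k).1 = halt.
Proof.
have [N [M [/andP[N_gt0 leNM] leMn len callN retM]]] := word_shape.
have shift := successor_shift (introT andP (conj N_gt0 leNM)) leMn len callN retM.
by exists N.-1; exact: words_halt shift.
Qed.

End ValidToHalting.

(** * From a halting computation to a valid word *)

Section HaltingToValid.
Variables (x m h : nat).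
Hypothesis x_gt0 : 0 < x.
Local Notation conf := (conf code init start x m).
Hypothesis halt_h : (conf h).1 = halt.
Hypothesis before_h : forall k, k < h -> (conf k).1 != halt.
Let N := m.+1.

Definition marker k : token_letter :=
  if k is k'.+1 then
    if (k == x) && (pad K \in (conf k').2) then LGo else LMark
  else LStart.

(** Blocks [0] to [h] carry the configurations up to the halting one, the first of them in calls;
    later blocks are all returns. *)
Definition word_letter k i : token_letter :=
  if h < k then LRet
  else if i is i'.+1 then
    if k == 0 then LPad else LTok (nth (pad K) (conf k).2 i')
  else marker k.

Definition halting_word j : token_letter := word_letter (j %/ N) (j %% N).

Local Notation mode_at := (@mode_at token_scheme halting_word).
Local Notation height_at := (@height_at token_scheme halting_word).

Lemma halting_wordE k i : i < N -> halting_word (k * N + i) = word_letter k i.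
Proof.
by move=> lti; rewrite /halting_word divnMDl // divn_small // addn0 modnMDl modn_small.
Qed.

Lemma conf_tokens k :
  (conf k.+1).2 = replace_first (source (conf k).1) (target (conf k).1) (conf k).2.
Proof.
by rewrite /=; case: (conf k) => l w; case: ifP; rewrite stepE.
Qed.

Lemma size_conf k : size (conf k).2 = m.
Proof. by elim: k => [|k IH]; rewrite ?size_nseq // conf_tokens size_replace_first. Qed.

Definition mode_after k i : token_mode :=
  MRun (k == 0) (conf k).1 (source (conf k).1 \in take i (conf k).2).

Definition mode_before k i : token_mode :=
  if i is i'.+1 then mode_after k i'
  else if k is k'.+1 then mode_after k' m else MStart.

Lemma mode_step k i : k <= h -> i < N ->
  token_next (mode_before k i) (word_letter k i) = Some (mode_after k i).
Proof.
rewrite /word_letter leqNgt => /negbTE->.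
case: i => [_|i lti].
  rewrite /mode_after take0; case: k => [|k] //=.
  rewrite /mode_after take_oversize ?size_conf //.
  case: ifP => [/andP[/eqP ex pw]|_].
    have ck : (conf k).1 = init by apply: conf_init; lia.
    by rewrite /= ck /source code_init pw.
  by rewrite /=; case: (conf k) => l w; rewrite stepE.
rewrite /mode_after (take_nth (pad K)) ?size_conf // mem_rcons inE orbC.
rewrite [source _ == _]eq_sym.
by case: k => [|k] //=; rewrite nth_nseq -ltnS lti.
Qed.

Lemma mode_atS j :
  mode_at j.+1 = odflt MStart (token_next (mode_at j) (halting_word j)).
Proof. by []. Qed.

Lemma mode_atE k i : k <= h -> i <= N -> mode_at (k * N + i) = mode_before k i.
Proof.
have next k' i' : k' <= h -> i' < N -> mode_at (k' * N + i') = mode_before k' i' ->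
    mode_at (k' * N + i'.+1) = mode_before k' i'.+1.
  by move=> lek lti e; rewrite addnS mode_atS e (halting_wordE _ lti) (mode_step lek lti).
elim: k i => [|k IH] i lek.
  elim: i => [|i IHi] lti; first by rewrite mul0n.
  by exact: next lek lti (IHi (ltnW lti)).
elim: i => [|i IHi] lti; last by exact: next lek lti (IHi (ltnW lti)).
by rewrite addn0 mulSnr (IH N (ltnW lek) (leqnn N)).
Qed.

Lemma position_split j : exists k i, [/\ i < N, j = k * N + i & j %/ N = k].
Proof.
exists (j %/ N), (j %% N); split=> //; first exact: ltn_pmod.
exact: divn_eq.
Qed.

Lemma mode_at_end i : i < N -> mode_at (h.+1 * N + i) =
  if i is 0 then mode_after h m else MEnd.
Proof.
elim: i => [|i IHi] lti.
  by rewrite addn0 mulSnr (mode_atE (leqnn h) (leqnn N)).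
rewrite addnS mode_atS (IHi (ltnW lti)) (halting_wordE _ (ltnW lti)) /word_letter ltnSn.
by case: (i).
Qed.

Lemma halting_word_class j : token_class (halting_word j) =
  if j < N then Call else if j < h.+1 * N then Internal else Return.
Proof.
have [k [i [lti -> _]]] := position_split j.
rewrite (halting_wordE _ lti) /word_letter; case: ltnP => [ltk|lek].
  have -> : (k * N + i < h.+1 * N) = false.
    by apply/negbTE; rewrite -leqNgt (leq_trans _ (leq_addr _ _)) // leq_mul2r ltk orbT.
  have -> : (k * N + i < N) = false; last by [].
  apply/negbTE; rewrite -leqNgt (leq_trans _ (leq_addr _ _)) //.
  by rewrite leq_pmull //; lia.
have -> : k * N + i < h.+1 * N.
  apply: (@leq_trans (k.+1 * N)); first by rewrite mulSnr ltn_add2l.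
  by rewrite leq_mul2r ltnS lek orbT.
case: k lek => [|k] lek.
  by rewrite mul0n add0n lti; case: i lti.
have -> : (k.+1 * N + i < N) = false by rewrite mulSn; lia.
by case: i lti => [|i] //= _; case: ifP.
Qed.

Lemma height_atE j : j <= h.+2 * N ->
  height_at j = if j <= N then j else if j <= h.+1 * N then N else N - (j - h.+1 * N).
Proof.
have leN : N <= h.+1 * N by rewrite mulSn leq_addr.
elim: j => [//|j IH] ltj; rewrite /= IH; last by lia.
rewrite /height /= halting_word_class.
have e2 : h.+2 * N = N + h.+1 * N by rewrite mulSn.
move: (h.+1 * N) leN e2 ltj => M leN -> ltj.
by repeat case: ifP; lia.
Qed.

(** Equal spacing puts the letter [N] positions later exactly one time unit later, and the marker of
    block [k] at time [k]. *)
Let rate (j : nat) : R := (N%:R^-1)%R.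

Lemma timeE j : time rate j = (j%:R / N%:R)%R.
Proof. by rewrite /time sumr_const card_ord mulr_natl. Qed.

Lemma halting_allowed k i : k <= h -> i < N ->
  token_allowed (mode_at (k * N + i)) (word_letter k i) (word_letter k.+1 i).
Proof.
move=> lek lti; rewrite (mode_atE lek (ltnW lti)) /token_allowed (mode_step lek lti).
rewrite {1}/mode_after /MRun.
case: (eqVneq (conf k).1 halt) => [eh|nh].
  (* No step before [h] is halting. *)
  have -> : k = h.
    by apply/eqP; rewrite eqn_leq lek leqNgt; apply/negP => /before_h; rewrite eh eqxx.
  by rewrite /word_letter ltnSn.
have ltk : k < h.
  by rewrite ltn_neqAle lek andbT; apply: contraNneq nh => ->; rewrite halt_h.
have [le1 le2] : (h < k) = false /\ (h < k.+1) = false by split; lia.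
rewrite /word_letter le1 le2.
case: i lti => [|i] lti.
  have -> : token_of (marker k) = None by case: (k) => //= k'; case: ifP.
  rewrite /=; case: ifP => // /andP[/eqP ex _].
  by rewrite conf_init ?eqxx //; lia.
have -> : token_of (if k == 0 then LPad else LTok (nth (pad K) (conf k).2 i)) =
    Some (nth (pad K) (conf k).2 i).
  by case: (k) => //=; rewrite nth_nseq -ltnS lti.
by rewrite -[conf k.+1]/(conf (k.+1)) conf_tokens nth_replace_first ?size_conf.
Qed.

Lemma halts_valid : @valid R token_scheme x halting_word rate (h.+2 * N).
Proof.
have rate_gt0 : (0 < (N%:R : R)^-1)%R by rewrite invr_gt0 ltr0n.
have retE j : is_return (S := token_scheme) (halting_word j) =
    ~~ (j < N) && (h.+1 * N <= j).
  rewrite /is_return /= halting_word_class [_ <= j]leqNgt.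
  by case: (j < N) => //; case: (j < _).
have leN : N <= h.+1 * N by rewrite mulSn leq_addr.
split.
- by move=> j _; exact: rate_gt0.
- move=> j; have [k [i [lti -> _]]] := position_split j.
  move=> ltj; have [lek|gtk] := leqP k h.
    rewrite (mode_atE lek (ltnW lti)) (halting_wordE _ lti).
    by rewrite [next_mode _ _](mode_step lek lti).
  have -> : k = h.+1.
    apply/eqP; rewrite eqn_leq gtk andbT -ltnS -(ltn_pmul2r (ltn0Sn m)).
    by apply: leq_ltn_trans ltj; rewrite leq_addr.
  rewrite (mode_at_end lti) (halting_wordE _ lti) /word_letter ltnSn.
  by case: (i).
- move=> j ltj; rewrite retE (height_atE (ltnW ltj)) => /andP[].
  rewrite mulSn in ltj; move: (h.+1 * N) leN ltj => M leN ltj.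
  by repeat case: ifP; lia.
- move=> j ltj; rewrite retE => nret.
  have ltM : j < h.+1 * N by move: nret; move: (h.+1 * N) leN => M leN; lia.
  exists (N + j); split.
  + by rewrite mulSn; lia.
  + by rewrite !timeE natrD mulrDl divff ?pnatr_eq0 // addrC.
  have [k [i [lti ej _]]] := position_split j.
  have lek : k <= h.
    rewrite -ltnS -(ltn_pmul2r (ltn0Sn m)).
    by apply: leq_ltn_trans ltM; rewrite ej leq_addr.
  rewrite ej addnA -mulSn (halting_wordE _ lti) (halting_wordE _ lti).
  exact: halting_allowed.
- move=> j _; have [k [i [lti -> _]]] := position_split j.
  rewrite (halting_wordE _ lti) /word_letter; case: ifP => // _.
  case: i lti => [|i] _; last by case: ifP.
  case: k => [|k] //=; case: ifP => // /andP[/eqP-> _] _.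
  by rewrite addn0 timeE natrM mulfK // pnatr_eq0.
Qed.

End HaltingToValid.
End Words.

(** * Codes of the automata and diagonalisation *)

Lemma rank_ord n (i : 'I_n) : rank i = i.
Proof. by rewrite /rank enum_rank_ord. Qed.

Lemma rank_index (T : finType) (x : T) : rank x = index x (enum T).
Proof.
rewrite /rank -[in RHS](nth_enum_rank x x) index_uniq ?enum_uniq //.
by rewrite -cardE.
Qed.

Lemma rank_None (T : finType) : rank (None : option T) = 0.
Proof. by rewrite rank_index enumT unlock. Qed.

Lemma size_code s : size s <= CodeSeq.code s.
Proof.
elim: s => //= n s IH; rewrite -[(size s).+1]mul1n leq_mul ?expn_gt0 //.
by rewrite ltnS; apply: leq_trans IH _; rewrite -addnn leq_addr.
Qed.

(** A set of ordinals is enumerated in increasing order, so the list is determined by its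
    members. *)
Lemma code_set_ord n (A : {set 'I_n}) (s : seq nat) :
  sorted ltn s -> (forall i : nat, (i \in s) = (i \in [seq val j | j <- enum A])) ->
  code_set A = CodeSeq.code s.
Proof.
move=> ss sA; rewrite /code_set (eq_map (@rank_ord n)); congr CodeSeq.code.
apply: (irr_sorted_eq ltn_trans ltnn) => //.
apply: (subseq_sorted ltn_trans _ (iota_ltn_sorted 0 n)).
by rewrite -val_enum_ord enumT; apply: map_subseq; exact: filter_subseq.
Qed.

Section Codes.
Variable S : scheme.
Hypothesis go_rank : rank (go S) = 0.

Definition edge_number (e : edge_data S) : nat :=
  let: (l, a, o, t) := e in
  CodeSeq.code [:: loc_rank l; rank a; code_constraint t.1.1; nat_of_counter_op o;
                   code_set (if t.1.2 then [set: 'I_1] else set0); loc_rank t.2].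

(** It depends on neither [N] nor [c], which allows both to be chosen from it afterwards. *)
Definition base_number : nat :=
  CodeSeq.code [seq edge_number e | e <- padding_edges S ++ base_edges S].

Lemma padding_le_base_number : nb_loc S + #|letter S| <= base_number.
Proof.
by apply: leq_trans (size_code _); rewrite size_map size_cat size_nseq leq_addr.
Qed.

(** The literals stand for [Timer], the letter [go], the guard on clock [0], [Noop], the empty reset
    set and [Acc]. *)
Definition go_edge_number (k : cmp_op) (c : nat) : nat :=
  CodeSeq.code [:: 3; 0; CodeSeq.code [:: CodeSeq.code [:: 0; nat_of_cmp k; c]];
                   2; 0; 0].

(** The nested product is the code of the edge list, with the two [go] edges in front of the list
    coded by [q]; the other literals are one clock, [Ini], and [Acc] with [End]. *)
Definition automaton_number (q sigma N c : nat) : nat :=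
  CodeSeq.code [:: sigma; N.+1; 1; CodeSeq.code [:: 2]; CodeSeq.code [:: 0; 1];
    2 ^ go_edge_number CLt c *
      (2 ^ go_edge_number CGt c * q.*2.+1).*2.+1].

Lemma rank_location N (l : loc S) : nb_loc S <= N.+1 ->
  rank (location_of N l) = loc_rank l.
Proof.
move=> leN; rewrite rank_ord inordK //; apply: leq_trans leN; exact: loc_rank_lt.
Qed.

Lemma code_edge_of N (e : edge_data S) : nb_loc S <= N.+1 ->
  code_edge (edge_of N e) = edge_number e.
Proof. by case: e => [[[l a] o] t] leN; rewrite /= !rank_location. Qed.

Lemma code_automaton N c : nb_loc S <= N.+1 ->
  code_toca (automaton S N c) = automaton_number base_number #|letter S| N c.
Proof.
move=> leN.
have locE (l : loc S) : val (location_of N l) = loc_rank l.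
  by rewrite -(rank_location l leN) rank_ord.
have initE : code_set [set location_of N (Ini S)] = CodeSeq.code [:: 2].
  by apply: code_set_ord => // i; rewrite enum_set1 /= locE.
have accE : code_set [set location_of N (Acc S); location_of N (End S)] =
    CodeSeq.code [:: 0; 1].
  apply: code_set_ord => // i; apply/idP/mapP => [|[j]].
    rewrite !inE => /orP[] /eqP->.
      by exists (location_of N (Acc S)); rewrite ?mem_enum ?set21 ?locE.
    by exists (location_of N (End S)); rewrite ?mem_enum ?set22 ?locE.
  by rewrite mem_enum => /set2P[] -> ->; rewrite locE.
have goE k : code_edge (edge_of N (go_edge S c k)) = go_edge_number k c.
  rewrite code_edge_of //= go_rank /code_constraint /= rank_ord.
  by rewrite /code_set enum_set0.
have map_edges (s : seq (edge_data S)) :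
    [seq code_edge e | e <- [seq edge_of N e | e <- s]] =
    [seq edge_number e | e <- s].
  by rewrite -map_comp; apply: eq_map => e; exact: code_edge_of.
have edgesE : [seq code_edge e | e <- edges (automaton S N c)] =
    [:: go_edge_number CLt c, go_edge_number CGt c &
        [seq edge_number e | e <- padding_edges S ++ base_edges S]].
  by rewrite -!goE -map_edges.
by rewrite /code_toca edgesE !card_ord initE accE.
Qed.

End Codes.

(** * The diagonal instance *)

Definition rgo_edge (k : cmp_op) : recfun :=
  rcode [:: rconst 3; rconst 0;
            rcode [:: rcode [:: rconst 0; rconst (nat_of_cmp k); Proj 0]];
            rconst 2; rconst 0; rconst 0].

(** Recovers [q] and [sigma] from [x] and rebuilds the code with both [N] and [c] equal to [x]. *)
Definition rinstance : recfun :=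
  rcode [:: rpair_exp2; Comp Succ [:: Proj 0]; rconst 1;
            rconst (CodeSeq.code [:: 2]); rconst (CodeSeq.code [:: 0; 1]);
            Comp rcons2 [:: rgo_edge CLt; Comp rcons2 [:: rgo_edge CGt; rpair_exp1]]].

Lemma computes_instance q sigma : sigma < 2 ^ q ->
  let x := pair_exp q sigma in computes rinstance [:: x] (automaton_number q sigma x x).
Proof.
move=> ltq x; have px : computes (Proj 0) [:: x] x by exact: (@computes_proj 0 [:: x]).
have cst n : computes (rconst n) [:: x] n := computes_const n [:: x].
have goP k : computes (rgo_edge k) [:: x] (go_edge_number k x).
  apply: computes_code; do 2!split=> //; split; last by do !split.
  by apply: computes_code; split=> //; apply: computes_code; do !split.
apply: computes_code; split; first exact: computes_pair_exp2.
split.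
  by apply: (@computes_Comp _ _ _ [:: x]); [split|exact: computes_succ].
do 3!split=> //.
split=> //; apply: (@computes_Comp _ _ _
  [:: go_edge_number CLt x; 2 ^ go_edge_number CGt x * q.*2.+1]).
  split=> //; split=> //.
  apply: (@computes_Comp _ _ _ [:: go_edge_number CGt x; q]).
    by do !split=> //; exact: computes_pair_exp1.
  exact: computes_cons2.
exact: computes_cons2.
Qed.

Theorem theorem3p4 (R : realType) :
  ~ decidable_problem code_toca (fun A => one_clock A /\ visibly A) (universal R).
Proof.
(* [h] maps [x] to the verdict of the supposed procedure on the automaton for [x]. *)
case=> f decides; set h := Comp f [:: rinstance].
(* Input in register [0], output in register [1], scratch from [2] on. *)
set p := compile h [:: 0] 1 2; set K := (maxn (max_reg p) 1).+1.
have pK : max_reg p < K by rewrite ltnS leq_maxl.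
have K_gt1 : 1 < K by rewrite ltnS leq_maxr.
set S := token_scheme (@code p K) (@l_init p) (@l_start p) (@l_halt p).
have code_init : code K (@l_init p) = (pad K, reg K 0, @l_init p, @l_init p) by [].
have init_halt : @l_init p != @l_halt p by [].
have go_rank : rank (go S) = 0 := rank_None _.
set q := base_number S; set sigma := #|letter S|.
have le_q : nb_loc S + sigma <= q := padding_le_base_number S.
have lt_sigma : sigma < 2 ^ q.
  by apply: leq_ltn_trans (ltn_expl q (ltnSn 1)); lia.
(* The scheme depends on [p] only, so [q] and [sigma] are fixed before [x]; run on this [x], the
   machine asks for the verdict on the very automaton that encodes this run. *)
set x := pair_exp q sigma.
have lt_qx : q < x by rewrite /x /pair_exp ltn_addr // ltn_expl.
have x_gt0 : 0 < x by lia.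
have leN : nb_loc S <= x.+1 by lia.
have go_int : class_of (go S) = Internal by [].
set A := automaton S x x.
have [|dec1 dec0] := decides A.
  by split; [exact: automaton_one_clock|exact: automaton_visibly].
have runs_to y : computes f [:: code_toca A] y ->
    exists2 s, exec p (upd (fun=> 0) 0 x) s & s 1 = y.
  rewrite (code_automaton go_rank x leN) => fy.
  have hy : computes h [:: x] y.
    by apply: computes_Comp fy; split=> //; exact: computes_instance.
  have [|||s [ps sy _]] := @compile_correct h [:: 0] 1 2 (upd (fun=> 0) 0 x) y => //.
  by exists s.
(* Verdict [1] makes the machine halt, which yields a rejected word; verdict [0] makes it run
   forever, so that no word is rejected. *)
have [univ|nuniv] := pselect (universal R A).
  have [s ps s1] := runs_to _ (dec1 univ).
  have [|m [k0 halts]] := machine_halts pK K_gt1 x_gt0 ps; first by rewrite s1.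
  (* [halts_valid] is about the first halting step. *)
  have hex :
      exists k, (conf (@code p K) (@l_init p) (@l_start p) x m k).1 == @l_halt p.
    by exists k0; apply/eqP.
  case: (ex_minnP hex) => k /eqP halt_k min_k.
  have before j : j < k ->
      (conf (@code p K) (@l_init p) (@l_start p) x m j).1 != @l_halt p.
    by move=> ltj; apply/negP => /min_k; lia.
  have val := halts_valid R code_init init_halt x_gt0 halt_k before.
  set w := halting_word _ _ _ _ _ _ in val; set d := (fun _ => _) in val.
  have d_ge0 j : (0 <= d j)%R by rewrite invr_ge0 ler0n.
  have bad := (@universalP R S x x go_int leN).1 univ
    (@segment R S w d 0 (k.+2 * m.+1)).
  have good := (@validP R S x w d _ d_ge0 (isT : 0 < k.+2 * m.+1)).2 val.
  rewrite bad // in good.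
  apply/allP => e /mapP[j _ ->]; exact: d_ge0.
have [s ps s1] := runs_to _ (dec0 nuniv).
have never := machine_diverges pK K_gt1 x_gt0 ps s1.
apply: nuniv; apply/(@universalP R S x x go_int leN) => r rn nnr.
(* A rejected word is valid, hence encodes a halting computation. *)
apply: contrapT => /negP good.
set a := fun j => (nth (LGo K, 0%R) r j).1.
set d := fun j => (nth (LGo K, 0%R) r j).2.
have rE : r = @segment R S a d 0 (size r).
  rewrite -[LHS](mkseq_nth (LGo K, 0%R)) /mkseq; apply: eq_map => j.
  by rewrite /a /d -surjective_pairing.
have d_ge0 j : (0 <= d j)%R.
  have [ltj|gej] := ltnP j (size r); last by rewrite /d nth_default.
  by have /(all_nthP (LGo K, 0%R))/(_ j ltj) := nnr.
have r_gt0 : 0 < size r by rewrite lt0n size_eq0.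
rewrite rE in good; have val := (@validP R S x a d _ d_ge0 r_gt0).1 good.
have [m [k]] := valid_halts code_init init_halt x_gt0 r_gt0 val.
exact/eqP/never.
Qed.
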